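(* Let $(R,\mathfrak m)$ be a Noetherian local ring of dimension $d\ge 1$, let $J$ be an $\mathfrak m$-primary ideal, let $h\in R$ be integral over $J$, and set $I=(J,h)$. Then \[ e_1(I)-e_1(J)\le \operatorname{red}_J(I)\cdot \lambda\big(R/(J:I)\big)\cdot f_0(J). \]
   Context: $\lambda$ denotes length. For an $\mathfrak m$-primary ideal $K$, the Hilbert coefficients $e_i(K)$ are the integers with $\lambda(R/K^{n+1})=\sum_{i=0}^{d}(-1)^i e_i(K)\binom{n+d-i}{d-i}$ for $n\gg0$. $f_0(K)$ is the multiplicity of the special fiber ring $\bigoplus_{n\ge0}K^n/\mathfrak mK^n$, i.e. $\nu(K^n)=f_0(K)\binom{n+d-1}{d-1}+(\text{lower order terms})$ for $n\gg0$. Since $h$ is integral over $J$, $J$ is a reduction of $I$; the reduction number $\operatorname{red}_J(I)$ is the least $s\ge0$ with $I^{s+1}=JI^s$. $J:I=\{r\in R: rI\subseteq J\}$. *)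

(* Defs.v *)
From HB Require Import structures.
From mathcomp Require Import all_boot all_order all_algebra.
From Stdlib Require Import ClassicalEpsilon.
Set Implicit Arguments. Unset Strict Implicit. Unset Printing Implicit Defensive.
Import Order.TTheory GRing.Theory Num.Theory.
Local Open Scope ring_scope.

Section CommAlg.
Variable R : comNzRingType.

Definition ideal (I : R -> Prop) : Prop :=
  I 0 /\ (forall x y, I x -> I y -> I (x + y)) /\ (forall r x, I x -> I (r * x)).

Definition eqI (I K : R -> Prop) : Prop := forall x, I x <-> K x.
Definition subI (I K : R -> Prop) : Prop := forall x, I x -> K x.
Definition ssubI (I K : R -> Prop) : Prop := subI I K /\ ~ subI K I.

Definition gen (S : R -> Prop) : R -> Prop :=
  fun x => forall K, ideal K -> subI S K -> K x.

Definition adjoin (J : R -> Prop) (h : R) : R -> Prop :=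
  gen (fun x => J x \/ x = h).

Definition prodI (I K : R -> Prop) : R -> Prop :=
  gen (fun x => exists a b, I a /\ K b /\ x = a * b).

Fixpoint powI (I : R -> Prop) (n : nat) : R -> Prop :=
  match n with
  | 0%N => fun _ => True
  | n'.+1 => prodI I (powI I n')
  end.

Definition colon (J I : R -> Prop) : R -> Prop :=
  fun r => forall x, I x -> J (r * x).

Definition prime_ideal (P : R -> Prop) : Prop :=
  ideal P /\ ~ P 1 /\ (forall a b, P (a * b) -> P a \/ P b).

Definition maximal_ideal (M : R -> Prop) : Prop :=
  ideal M /\ ~ M 1 /\ (forall K, ideal K -> subI M K -> ~ K 1 -> subI K M).

Definition local_with (m : R -> Prop) : Prop :=
  maximal_ideal m /\ (forall M, maximal_ideal M -> eqI M m).

Definition noetherian : Prop :=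
  forall I, ideal I -> exists s : seq R, eqI I (gen (fun x => x \in s)).

Definition prime_chain (f : nat -> R -> Prop) (n : nat) : Prop :=
  (forall i, (i <= n)%N -> prime_ideal (f i)) /\
  (forall i, (i < n)%N -> ssubI (f i) (f i.+1)).

Definition krull_dim (d : nat) : Prop :=
  (exists f, prime_chain f d) /\ (forall f n, prime_chain f n -> (n <= d)%N).

Definition m_primary (m J : R -> Prop) : Prop :=
  ideal J /\ ~ J 1 /\ subI J m /\ (forall x, m x -> exists n, J (x ^+ n)).

Definition integral_over (J : R -> Prop) (h : R) : Prop :=
  exists (k : nat) (a : nat -> R), (1 <= k)%N /\
    (forall i, (1 <= i <= k)%N -> powI J i (a i)) /\
    h ^+ k + \sum_(1 <= i < k.+1) a i * h ^+ (k - i) = 0.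

(* length of R/K as an R-module: maximal length of a strict chain of ideals
   K = K_0 ⊊ K_1 ⊊ ... ⊊ K_l = R *)
Definition ideal_chain (K : R -> Prop) (f : nat -> R -> Prop) (l : nat) : Prop :=
  eqI (f 0%N) K /\ eqI (f l) (fun _ => True) /\
  (forall i, (i <= l)%N -> ideal (f i)) /\
  (forall i, (i < l)%N -> ssubI (f i) (f i.+1)).

Definition length_is (K : R -> Prop) (l : nat) : Prop :=
  (exists f, ideal_chain K f l) /\ (forall f l', ideal_chain K f l' -> (l' <= l)%N).

Definition lengthR (K : R -> Prop) : nat :=
  epsilon (inhabits 0%N) (fun l => length_is K l).

Definition mingens_is (K : R -> Prop) (k : nat) : Prop :=
  (exists s : seq R, size s = k /\ eqI K (gen (fun x => x \in s))) /\
  (forall s : seq R, eqI K (gen (fun x => x \in s)) -> (k <= size s)%N).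

Definition nu (K : R -> Prop) : nat :=
  epsilon (inhabits 0%N) (fun k => mingens_is K k).

Definition hilb_coeff (K : R -> Prop) (d : nat) : nat -> int :=
  epsilon (inhabits (fun _ => 0)) (fun e : nat -> int =>
    exists N, forall n, (N <= n)%N ->
      (lengthR (powI K n.+1))%:Z =
      \sum_(i < d.+1) (-1) ^+ i * e i * ('C(n + d - i, d - i))%:Z).

Definition f0 (K : R -> Prop) (d : nat) : int :=
  epsilon (inhabits 0) (fun f : int =>
    exists (c : nat -> int) N, forall n, (N <= n)%N ->
      (nu (powI K n))%:Z =
      f * ('C(n + d - 1, d - 1))%:Z + \sum_(j < d.-1) c j * ('C(n + j, j))%:Z).

Definition red (J I : R -> Prop) : nat :=
  epsilon (inhabits 0%N) (fun s =>
    eqI (powI I s.+1) (prodI J (powI I s)) /\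
    (forall t, eqI (powI I t.+1) (prodI J (powI I t)) -> (s <= t)%N)).

End CommAlg.

(* Main.v *)
Require Import Defs.
From HB Require Import structures.
From mathcomp Require Import all_boot all_order all_algebra.
From mathcomp Require Import ring zify.
From Stdlib Require Import Classical ClassicalEpsilon.
From Stdlib Require Import FunctionalExtensionality PropExtensionality.
Set Implicit Arguments. Unset Strict Implicit. Unset Printing Implicit Defensive.
Import Order.TTheory GRing.Theory Num.Theory.
Local Open Scope ring_scope.

(* Let [s] be the reduction number, so that [I^(n+1) = J^(n+1-s) I^s] for
   [n >= s].  In the chain [D_i = J^(n+1-i) I^i], [0 <= i <= s], from [J^(n+1)]
   to [I^(n+1)] one has [D_(i+1) = D_i + h^(i+1) J^(n-i)], and [J : I] maps
   [h^(i+1) J^(n-i)] into [D_i]; hence [D_(i+1) / D_i] is a quotient of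
   [J^(n-i) / (J : I) J^(n-i)] and has length at most
   [nu(J^(n-i)) * length(R / (J : I))].  Summing over [i],
     [0 <= length(R/J^(n+1)) - length(R/I^(n+1))
        <= length(R / (J : I)) * (nu(J^n) + ... + nu(J^(n+1-s)))].
   The right-hand side is a polynomial of degree at most [d - 1] in [n], so
   [e_0(I) = e_0(J)], and comparing the coefficients of degree [d - 1] gives
   the bound.  The Hilbert functions are polynomial by induction on the number
   of generators of the graded module (Hilbert-Serre), finite generation of
   kernels coming from the noetherian Rees algebra; the degree bounds come from
   an m-primary ideal inside [J] generated by [d] elements. *)

(** * Ideals and lengths of intervals of ideals *)

Section Ideals.
Variable R : comNzRingType.
Implicit Types A B C K L : R -> Prop.

Lemma subI_antisym A B : subI A B -> subI B A -> A = B.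
Proof.
move=> AB BA; apply: functional_extensionality => x.
by apply: propositional_extensionality; split; [apply: AB | apply: BA].
Qed.

Lemma eqI_eq A B : eqI A B -> A = B.
Proof. by move=> AB; apply: subI_antisym => x /AB. Qed.

Lemma subI_refl A : subI A A. Proof. by []. Qed.

Lemma subI_trans B A C : subI A B -> subI B C -> subI A C.
Proof. by move=> AB BC x /AB /BC. Qed.

Lemma ideal0 A : ideal A -> A 0. Proof. by case. Qed.

Lemma idealD A x y : ideal A -> A x -> A y -> A (x + y).
Proof. by case=> _ [+ _]; apply. Qed.

Lemma idealMl A r x : ideal A -> A x -> A (r * x).
Proof. by case=> _ [_]; apply. Qed.

Lemma idealMr A r x : ideal A -> A x -> A (x * r).
Proof. by rewrite mulrC; apply: idealMl. Qed.

Lemma idealN A x : ideal A -> A x -> A (- x).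
Proof. by move=> iA Ax; rewrite -mulN1r; apply: idealMl. Qed.

Lemma idealB A x y : ideal A -> A x -> A y -> A (x - y).
Proof. by move=> iA Ax Ay; apply: idealD => //; apply: idealN. Qed.

Lemma ideal_sum A (I : Type) (r : seq I) (P : pred I) (F : I -> R) :
  ideal A -> (forall i, P i -> A (F i)) -> A (\sum_(i <- r | P i) F i).
Proof.
move=> iA AF; apply: (big_ind A) => //; first exact: ideal0.
by move=> x y; apply: idealD.
Qed.

Lemma ideal1 A : ideal A -> A 1 -> A = fun=> True.
Proof.
move=> iA A1; apply: subI_antisym => // x _.
by rewrite -[x]mulr1; apply: idealMl.
Qed.

Definition fullI : R -> Prop := fun=> True.

Lemma ideal_full : ideal fullI. Proof. by []. Qed.

Definition zeroI : R -> Prop := fun x => x = 0.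

Lemma ideal_zero : ideal zeroI.
Proof.
by split=> //; split=> [x y -> ->|r x ->]; rewrite /zeroI ?addr0 ?mulr0.
Qed.

Definition capI A B : R -> Prop := fun x => A x /\ B x.

Lemma ideal_cap A B : ideal A -> ideal B -> ideal (capI A B).
Proof.
move=> iA iB; split; first by split; apply: ideal0.
split=> [x y [? ?] [? ?]|r x [? ?]]; first by split; apply: idealD.
by split; apply: idealMl.
Qed.

Definition addx A x B : R -> Prop :=
  fun y => exists a b, [/\ A a, B b & y = a + x * b].

(** This is the kernel of multiplication by [x] from [B] to [R/A], so for ideals [B / pre A x B] is
    isomorphic to [addx A x B / A]. *)
Definition pre A x B : R -> Prop := fun b => B b /\ A (x * b).

Lemma ideal_addx A x B : ideal A -> ideal B -> ideal (addx A x B).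
Proof.
move=> iA iB; split.
  by exists 0, 0; split; rewrite ?mulr0 ?addr0 //; apply: ideal0.
split=> [_ _ [a [b [Aa Bb ->]]] [a' [b' [Aa' Bb' ->]]]|r _ [a [b [Aa Bb ->]]]].
  exists (a + a'), (b + b'); split; first exact: idealD.
    exact: idealD.
  by ring.
exists (r * a), (r * b); split; first exact: idealMl.
  exact: idealMl.
by ring.
Qed.

Lemma ideal_pre A x B : ideal A -> ideal B -> ideal (pre A x B).
Proof.
move=> iA iB; split; first by split; rewrite ?mulr0; apply: ideal0.
split=> [y z [? ?] [? ?]|r y [? ?]].
  by split; rewrite ?mulrDr; apply: idealD.
by split; rewrite 1?mulrCA; apply: idealMl.
Qed.

Lemma addx_l A x B : ideal B -> subI A (addx A x B).
Proof.
move=> iB a Aa; exists a, 0; split=> //; first exact: ideal0.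
by rewrite mulr0 addr0.
Qed.

Lemma addx_r A x B b : ideal A -> B b -> addx A x B (x * b).
Proof.
by move=> iA Bb; exists 0, b; split=> //; [apply: ideal0 | rewrite add0r].
Qed.

Lemma addx_x A x : ideal A -> addx A x fullI x.
Proof. by move=> iA; exists 0, 1; split; rewrite ?add0r ?mulr1 //; apply: ideal0. Qed.

Lemma addx_min A x B K : ideal K -> subI A K -> (forall b, B b -> K (x * b)) ->
  subI (addx A x B) K.
Proof.
by move=> iK AK BK _ [a [b [/AK Ka /BK Kb ->]]]; apply: idealD.
Qed.

Lemma addx_mono A A' x B B' : subI A A' -> subI B B' ->
  subI (addx A x B) (addx A' x B').
Proof. by move=> AA BB _ [a [b [/AA ? /BB ? ->]]]; exists a, b. Qed.

(** Both ends are kept free so that chains measure any subquotient [B / A], not only [R / K]. *)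
Inductive chain : (R -> Prop) -> (R -> Prop) -> nat -> Prop :=
| chain0 A : ideal A -> chain A A 0
| chainS A A' B l : ideal A -> ssubI A A' -> chain A' B l -> chain A B l.+1.

Lemma chain_ideal A B l : chain A B l -> [/\ ideal A, ideal B & subI A B].
Proof.
elim=> {A B l} [A iA|A A' B l iA [AA' _] _ [iA' iB AB]]; split=> //.
exact: subI_trans AB.
Qed.

Lemma chain_cat A B C l k : chain A B l -> chain B C k -> chain A C (l + k).
Proof.
by elim=> {A B l} [//|A A' B l iA sA _ IH /IH]; rewrite addSn; apply: chainS.
Qed.

Lemma ssubI_or A B : subI A B -> A = B \/ ssubI A B.
Proof.
move=> AB; case: (classic (subI B A)) => BA; last by right.
by left; apply: subI_antisym.
Qed.

Lemma chain_cons A A' B l : ideal A -> subI A A' -> chain A' B l ->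
  exists l', [/\ chain A B l', (l <= l')%N & ssubI A A' -> (l < l')%N].
Proof.
move=> iA AA' c; case: (ssubI_or AA') => [E|s].
  by exists l; rewrite E; split=> // -[_ []].
by exists l.+1; split=> //; apply: chainS c.
Qed.

(* By the modular law a strict inclusion [G < G'] stays strict after
   intersecting with [B] or after adding [B]. *)
Lemma chain_split B G C l : ideal B -> chain G C l ->
  exists l1 l2, [/\ chain (capI G B) (capI C B) l1,
    chain (addx G 1 B) (addx C 1 B) l2 & (l <= l1 + l2)%N].
Proof.
move=> iB; elim=> {G C l} [A iA|G G' C l iG [GG' nGG'] cG [l1 [l2 [c1 c2 le]]]].
  exists 0%N, 0%N; split=> //; apply: chain0; first exact: ideal_cap.
  exact: ideal_addx.
have [iG' _ _] := chain_ideal cG.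
have s1 : subI (capI G B) (capI G' B) by move=> x [/GG' ? ?]; split.
have s2 : subI (addx G 1 B) (addx G' 1 B) by apply: addx_mono.
have [k1 [d1 le1 lt1]] := chain_cons (ideal_cap iG iB) s1 c1.
have [k2 [d2 le2 lt2]] := chain_cons (ideal_addx 1 iG iB) s2 c2.
exists k1, k2; split=> //.
case: (ssubI_or s1) => [E1|/lt1]; last by lia.
case: (ssubI_or s2) => [E2|/lt2]; last by lia.
case: nGG' => x G'x.
have [g [b [Gg Bb Ex]]] : addx G 1 B x by rewrite E2; apply: addx_l.
rewrite mul1r in Ex.
have : capI G B b.
  rewrite E1; split=> //; have -> : b = x - g by rewrite Ex; ring.
  by apply: idealB => //; apply: GG'.
by case=> Gb _; rewrite Ex; apply: idealD.
Qed.

(** Finite length of the module [B / A]; [len] below is meaningful only when this holds. *)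
Definition flen A B : Prop :=
  [/\ ideal A, ideal B, subI A B & exists n, forall l, chain A B l -> (l <= n)%N].

Definition len A B : nat :=
  epsilon (inhabits 0%N) (fun l => chain A B l /\
    forall l', chain A B l' -> (l' <= l)%N).

Lemma max_nat (P : nat -> Prop) n : (exists l, P l) ->
  (forall l, P l -> (l <= n)%N) -> exists l, P l /\ forall l', P l' -> (l' <= l)%N.
Proof.
move=> [l0 P0]; elim: n => [|n IH] bd.
  by exists l0; split=> // l' /bd; rewrite leqn0 => /eqP ->.
case: (classic (P n.+1)) => [Pn|nP]; first by exists n.+1.
apply: IH => l Pl; have := bd _ Pl; rewrite leq_eqVlt => /orP[/eqP E|//].
by case: nP; rewrite -E.
Qed.

Lemma lenP A B : flen A B ->
  chain A B (len A B) /\ forall l, chain A B l -> (l <= len A B)%N.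
Proof.
case=> iA iB AB [n bd].
suff ex : exists l, chain A B l by exact: (epsilon_spec _ _ (max_nat ex bd)).
case: (ssubI_or AB) => [<-|s]; first by exists 0%N; apply: chain0.
by exists 1%N; exact: (chainS iA s (chain0 iB)).
Qed.

Lemma len_chain A B l : flen A B -> chain A B l -> (l <= len A B)%N.
Proof. by case/lenP => _; apply. Qed.

Lemma len_le A B n : flen A B -> (forall l, chain A B l -> (l <= n)%N) ->
  (len A B <= n)%N.
Proof. by case/lenP => c _; apply. Qed.

Lemma flen_refl A : ideal A -> flen A A.
Proof.
move=> iA; split=> //; exists 0%N => l c; inversion c as [|X A' Y k _ [AA' nA'A] c'] => //.
by have [_ _] := chain_ideal c'.
Qed.

Lemma len_refl A : ideal A -> len A A = 0%N.
Proof.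
move=> iA; apply/eqP; rewrite -leqn0; apply: len_le; first exact: flen_refl.
move=> l c; inversion c as [|X A' Y k _ [AA' nA'A] c'] => //.
by have [_ _] := chain_ideal c'.
Qed.

(** Intersecting a chain with [B] gives one from [A] to [B], adding [B] gives one from [B] to [C];
    this is [chain_split] with the ends simplified. *)
Lemma chain_between A B C l : ideal B -> subI A B -> subI B C -> chain A C l ->
  exists l1 l2, [/\ chain A B l1, chain B C l2 & (l <= l1 + l2)%N].
Proof.
move=> iB AB BC c; have [iA iC _] := chain_ideal c.
have [l1 [l2 [c1 c2 le]]] := chain_split iB c.
exists l1, l2; split=> //.
  have -> : A = capI A B by apply: subI_antisym => [x ?|x []//]; split=> //; apply: AB.
  have {2}-> : B = capI C B by apply: subI_antisym => [x ?|x []//]; split=> //; apply: BC.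
  by [].
have -> : B = addx A 1 B.
  apply: subI_antisym => [x Bx|]; first by rewrite -[x]mul1r; apply: addx_r.
  by apply: addx_min => // b; rewrite mul1r.
have -> : C = addx C 1 B.
  apply: subI_antisym; first exact: addx_l.
  by apply: addx_min => // b /BC; rewrite mul1r.
by [].
Qed.

Lemma flen_trans B A C : flen A B -> flen B C -> flen A C.
Proof.
move=> [iA iB AB [n bn]] [_ iC BC [k bk]]; split=> //; first exact: subI_trans BC.
exists (n + k)%N => l /(chain_between iB AB BC)[l1 [l2 [/bn ? /bk ?]]]; lia.
Qed.

Lemma flen_l B A C : flen A C -> ideal B -> subI A B -> subI B C -> flen A B.
Proof.
move=> [iA iC _ [n bn]] iB AB BC; split=> //; exists n => l c.
have [l' [c' _ _]] := chain_cons iB BC (chain0 iC).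
by have := bn _ (chain_cat c c'); lia.
Qed.

Lemma flen_r B A C : flen A C -> ideal B -> subI A B -> subI B C -> flen B C.
Proof.
move=> [iA iC _ [n bn]] iB AB BC; split=> //; exists n => l c.
have [l' [c' _ _]] := chain_cons iA AB (chain0 iB).
by have := bn _ (chain_cat c' c); lia.
Qed.

Lemma len_add B A C : flen A B -> flen B C -> len A C = (len A B + len B C)%N.
Proof.
move=> fAB fBC; have fAC := flen_trans fAB fBC.
have [iA iB AB _] := fAB; have [_ _ BC _] := fBC.
apply/eqP; rewrite eqn_leq; apply/andP; split.
  apply: len_le => // l /(chain_between iB AB BC)[l1 [l2 []]].
  move=> /(len_chain fAB) ? /(len_chain fBC) ?; lia.
apply: len_chain => //.
exact: chain_cat (proj1 (lenP fAB)) (proj1 (lenP fBC)).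
Qed.

Lemma len_mono A A' B B' : flen A B -> ideal A' -> ideal B' ->
  subI A A' -> subI A' B' -> subI B' B ->
  flen A' B' /\ (len A' B' <= len A B)%N.
Proof.
move=> fAB iA' iB' AA' AB BB'.
have f1 : flen A' B by apply: flen_r fAB _ _ _ => //; apply: subI_trans BB'.
have f2 : flen A A' by apply: flen_l fAB _ _ _ => //; apply: subI_trans BB'.
have f3 : flen A' B' by apply: flen_l f1 _ _ _.
have f4 : flen B' B by apply: flen_r f1 _ _ _.
by split=> //; rewrite (len_add f2 f1) (len_add f3 f4); lia.
Qed.

(** Multiplication by [x] makes [(A + xB) / A] a quotient of [B / K]. Chains are pulled back by
    [pre]; they stay strict because every element of the upper ideal has the form [a + x b] with [a]
    in [A]. *)
Lemma len_image K A x B : flen K B -> ideal A ->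
  (forall b, K b -> A (x * b)) ->
  flen A (addx A x B) /\ (len A (addx A x B) <= len K B)%N.
Proof.
move=> fKB iA KA; have [iK iB KB _] := fKB.
have tr G H l : chain G H l -> subI A G -> subI H (addx A x B) ->
    chain (pre G x B) (pre H x B) l.
  elim=> {G H l} [G iG _ _|G G' H l iG [GG' nG'G] c IH AG HB].
    by apply: chain0; apply: ideal_pre.
  have AG' : subI A G' by apply: subI_trans GG'.
  have [iG' _ G'H] := chain_ideal c.
  apply: chainS (IH AG' HB); first exact: ideal_pre.
  split=> [b [? /GG' ?]|s]; first by split.
  apply: nG'G => y G'y; have /HB[a [b [Aa Bb Ey]]] := G'H _ G'y.
  rewrite Ey; apply: idealD => //; first exact: AG.
  suff /s[] : pre G' x B b by [].
  split=> //; have -> : x * b = y - a by rewrite Ey; ring.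
  by apply: idealB => //; apply: AG'.
have bd l : chain A (addx A x B) l -> (l <= len K B)%N.
  move/tr => /(_ (@subI_refl _) (@subI_refl _)).
  have -> : pre (addx A x B) x B = B.
    by apply: subI_antisym => [b []//|b Bb]; split=> //; apply: addx_r.
  move=> c; have KP : subI K (pre A x B) by move=> b Kb; split; [apply: KB | apply: KA].
  have [l' [c' le _]] := chain_cons iK KP c.
  by apply: leq_trans le _; apply: len_chain.
have f : flen A (addx A x B).
  by split=> //; [apply: ideal_addx | apply: addx_l | exists (len K B)].
by split=> //; apply: len_le.
Qed.

(** Here the whole kernel is factored out, so chains can also be pushed forward by [addx A x], which
    gives the inequality missing from [len_image]. *)
Lemma len_image_eq A x B : ideal A -> flen (pre A x B) B ->
  len A (addx A x B) = len (pre A x B) B.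
Proof.
move=> iA fB; have [iP iB PB _] := fB.
have [f le] : flen A (addx A x B) /\ (len A (addx A x B) <= len (pre A x B) B)%N.
  by apply: len_image => // b [].
apply/eqP; rewrite eqn_leq le /=; apply: len_le => // l c.
have tr G H : chain G H l -> subI (pre A x B) G -> subI H B ->
    chain (addx A x G) (addx A x H) l.
  elim=> {G H l c} [G iG _ _|G G' H l iG [GG' nG'G] c IH PG HB].
    by apply: chain0; apply: ideal_addx.
  have [iG' _ G'H] := chain_ideal c.
  apply: chainS (IH _ _) => //; [exact: ideal_addx | split | exact: subI_trans GG'].
    exact: addx_mono.
  move=> s; apply: nG'G => y G'y.
  have /s[a [g [Aa Gg E]]] : addx A x G' (x * y) by apply: addx_r.
  have -> : y = g + (y - g) by ring.
  apply: idealD => //; apply: PG; split.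
    by apply: HB; apply: G'H; apply: idealB => //; apply: GG'.
  by have -> : x * (y - g) = a by rewrite mulrBr E; ring.
have := tr _ _ c (@subI_refl _) (@subI_refl _).
have -> : addx A x (pre A x B) = A.
  apply: subI_antisym; last exact: addx_l.
  by apply: addx_min => // b [].
by move=> c'; apply: len_chain.
Qed.

Lemma ideal_chain_chain K f l : ideal_chain K f l -> chain K fullI l.
Proof.
case=> /eqI_eq <- [/eqI_eq E [id st]].
suff H k : (k <= l)%N -> chain (f (l - k)%N) fullI k.
  by have := H l (leqnn l); rewrite subnn.
elim: k => [_|k IH lt]; first by rewrite subn0 E; apply: chain0.
apply: chainS (IH (ltnW lt)); first by apply: id; lia.
have -> : (l - k = (l - k.+1).+1)%N by lia.
by apply: st; lia.
Qed.

Lemma chain_ideal_chain K l : chain K fullI l -> exists f, ideal_chain K f l.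
Proof.
suff H F : chain K F l -> F = fullI -> exists f, ideal_chain K f l by move/H; apply.
elim=> {K F l} [K iK E|A A' B l iA sA c IH E].
  by exists (fun=> K); split=> //; split; [rewrite E | split].
have [f [f0 [fl [id st]]]] := IH E.
exists (fun i => if i is i'.+1 then f i' else A); split=> //; split=> //.
split=> [[//|i] /id//|[|i]]; last exact: st.
by rewrite (eqI_eq f0).
Qed.

Lemma lengthR_len K : flen K fullI -> lengthR K = len K fullI.
Proof.
move=> fK; have [c bd] := lenP fK; have [f Hf] := chain_ideal_chain c.
have ex : exists l, length_is K l.
  by exists (len K fullI); split; [exists f | move=> g l /ideal_chain_chain /bd].
have [[g Hg] mx] := epsilon_spec (inhabits 0%N) _ ex.
apply/eqP; rewrite eqn_leq; apply/andP; split.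
  exact: bd (ideal_chain_chain Hg).
exact: mx Hf.
Qed.

End Ideals.

(** * Products, powers and finitely generated ideals *)

Section Products.
Variable R : comNzRingType.
Implicit Types A B C K L : R -> Prop.

Lemma ideal_gen (S : R -> Prop) : ideal (gen S).
Proof.
split; first by move=> K [].
split=> [x y Sx Sy K iK SK|r x Sx K iK SK].
  by apply: idealD => //; [apply: Sx | apply: Sy].
by apply: idealMl => //; apply: Sx.
Qed.

Lemma gen_sub (S : R -> Prop) x : S x -> gen S x.
Proof. by move=> Sx K _; apply. Qed.

Lemma gen_min (S : R -> Prop) K : ideal K -> subI S K -> subI (gen S) K.
Proof. by move=> iK SK x; apply. Qed.

Definition span (s : seq R) : R -> Prop := gen (fun x => x \in s).

Lemma ideal_span s : ideal (span s). Proof. exact: ideal_gen. Qed.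

Lemma span_mem s x : x \in s -> span s x. Proof. exact: gen_sub. Qed.

Lemma span_min s K : ideal K -> (forall x, x \in s -> K x) -> subI (span s) K.
Proof. exact: gen_min. Qed.

Lemma span_subseq (s t : seq R) : {subset s <= t} -> subI (span s) (span t).
Proof. by move=> st; apply: span_min (ideal_span _) _ => x /st; apply: span_mem. Qed.

Lemma span_nil : span [::] = @zeroI R.
Proof.
apply: subI_antisym; first exact: span_min (ideal_zero R) _.
by move=> x ->; apply: ideal0; apply: ideal_span.
Qed.

Lemma span_cons x s : span (x :: s) = addx (span s) x (@fullI R).
Proof.
have iS := ideal_span s.
apply: subI_antisym.
  apply: span_min; first exact: ideal_addx.
  move=> y; rewrite inE => /orP[/eqP ->|ys].
    exact: addx_x.
  by apply: addx_l => //; apply: span_mem.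
apply: addx_min => [||b _]; first exact: ideal_span.
  apply: span_min => [|y ys]; first exact: ideal_span.
  by apply: span_mem; rewrite inE ys orbT.
exact: idealMr (ideal_span _) (span_mem (mem_head _ _)).
Qed.

Definition adds A (s : seq R) := foldl (fun B x => addx B x (@fullI R)) A s.

Lemma ideal_adds A s : ideal A -> ideal (adds A s).
Proof. by elim: s A => //= x s IH A iA; apply: IH; apply: ideal_addx. Qed.

Lemma adds_l A s : subI A (adds A s).
Proof.
elim: s A => [|x s IH] A /=; first exact: subI_refl.
by move=> y Ay; apply: IH; apply: addx_l.
Qed.

Lemma adds_mem A s x : ideal A -> x \in s -> adds A s x.
Proof.
elim: s A => //= y s IH A iA; rewrite inE => /orP[/eqP ->|]; last first.
  by apply: IH; apply: ideal_addx.
by apply: adds_l; apply: addx_x.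
Qed.

Lemma adds_min A s K : ideal K -> subI A K -> (forall x, x \in s -> K x) ->
  subI (adds A s) K.
Proof.
move=> iK; elim: s A => //= x s IH A AK sK; apply: IH.
  apply: addx_min => // b _; apply: idealMr => //.
  by apply: sK; rewrite mem_head.
by move=> y ys; apply: sK; rewrite inE ys orbT.
Qed.

Lemma prodI_mem A B a b : A a -> B b -> prodI A B (a * b).
Proof. by move=> Aa Bb; apply: gen_sub; exists a, b. Qed.

Lemma ideal_prodI A B : ideal (prodI A B). Proof. exact: ideal_gen. Qed.

Lemma prodI_min A B K : ideal K -> (forall a b, A a -> B b -> K (a * b)) ->
  subI (prodI A B) K.
Proof.
by move=> iK AB; apply: gen_min => // _ [a [b [Aa [Bb ->]]]]; apply: AB.
Qed.

Lemma prodI_mono A A' B B' : subI A A' -> subI B B' ->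
  subI (prodI A B) (prodI A' B').
Proof.
move=> AA BB; apply: prodI_min; first exact: ideal_prodI.
by move=> a b /AA ? /BB ?; apply: prodI_mem.
Qed.

Lemma prodIC A B : prodI A B = prodI B A.
Proof.
have H C D : subI (prodI C D) (prodI D C).
  apply: prodI_min; first exact: ideal_prodI.
  by move=> a b Ca Db; rewrite mulrC; apply: prodI_mem.
exact: subI_antisym.
Qed.

Lemma prodI_subr A B : ideal B -> subI (prodI A B) B.
Proof. by move=> iB; apply: prodI_min => // a b _ Bb; apply: idealMl. Qed.

Lemma prodI_subl A B : ideal A -> subI (prodI A B) A.
Proof. by rewrite prodIC; apply: prodI_subr. Qed.

Lemma prodIA A B C : prodI A (prodI B C) = prodI (prodI A B) C.
Proof.
have H A' B' C' : subI (prodI A' (prodI B' C')) (prodI (prodI A' B') C').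
  apply: prodI_min => [|a x Aa]; first exact: ideal_prodI.
  (* The elements whose product with [a] lies in the target form an ideal, so only the generators
     [b * c] need testing. The same device recurs below. *)
  have iT : ideal (fun y => prodI (prodI A' B') C' (a * y)).
    have iP := ideal_prodI (prodI A' B') C'.
    split; first by rewrite mulr0; apply: ideal0.
    split=> [u v ? ?|r u ?]; first by rewrite mulrDr; apply: (idealD iP).
    by rewrite mulrCA; apply: (idealMl r iP).
  suff : subI (prodI B' C') (fun y => prodI (prodI A' B') C' (a * y)) by apply.
  apply: prodI_min => // b c Bb Cc; rewrite mulrA.
  by do 2?[apply: prodI_mem => //].
apply: subI_antisym; first exact: H.
rewrite (prodIC (prodI A B) C) (prodIC A B) (prodIC A (prodI B C)) (prodIC B C).
exact: H.
Qed.

Lemma prodI_full A : ideal A -> prodI A (@fullI R) = A.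
Proof.
move=> iA; apply: subI_antisym; first exact: prodI_subl.
by move=> x Ax; rewrite -[x]mulr1; apply: prodI_mem.
Qed.

Lemma ideal_powI K n : ideal (powI K n).
Proof. by case: n => [|n]; [apply: ideal_full | apply: ideal_prodI]. Qed.

Lemma powID K a b : prodI (powI K a) (powI K b) = powI K (a + b).
Proof.
elim: a => [|a IH]; first by rewrite prodIC prodI_full //; apply: ideal_powI.
by rewrite addSn /= -IH prodIA.
Qed.

Lemma powI_mono K L n : subI K L -> subI (powI K n) (powI L n).
Proof. by move=> KL; elim: n => //= n IH; apply: prodI_mono. Qed.

Lemma powI_exp K x n : K x -> powI K n (x ^+ n).
Proof. by move=> Kx; elim: n => //= n IH; rewrite exprS; apply: prodI_mem. Qed.

(** Each [x] in [s] adds a cyclic module killed by [C], hence a quotient of [R / C]. *)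
Lemma len_adds C A s : flen C (@fullI R) -> ideal A ->
  (forall x c, x \in s -> C c -> A (x * c)) ->
  flen A (adds A s) /\ (len A (adds A s) <= size s * len C (@fullI R))%N.
Proof.
move=> fC; elim: s A => [|x s IH] A iA AC /=.
  by split; [apply: flen_refl | rewrite len_refl].
have iA' : ideal (addx A x (@fullI R)) by apply: ideal_addx.
have [|f1 l1] := IH _ iA'.
  by move=> y c ys Cc; apply: addx_l => //; apply: AC => //; rewrite inE ys orbT.
have [|f2 l2] := len_image (x := x) fC iA.
  by move=> c Cc; apply: AC => //; rewrite mem_head.
split; first exact: flen_trans f2 f1.
by rewrite (len_add f2 f1) mulSn leq_add.
Qed.

Lemma adds_span A s : subI A (span s) -> ideal A -> adds A s = span s.
Proof.
move=> As iA; apply: subI_antisym.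
  by apply: adds_min => // [|x]; [apply: ideal_span | apply: span_mem].
by apply: span_min => [|x]; [apply: ideal_adds | apply: adds_mem].
Qed.

Lemma len_prod_span C s : flen C (@fullI R) ->
  flen (prodI C (span s)) (span s) /\
  (len (prodI C (span s)) (span s) <= size s * len C (@fullI R))%N.
Proof.
move=> fC; have iP := ideal_prodI C (span s).
have [|] := @len_adds C _ s fC iP.
  by move=> x c xs Cc; rewrite mulrC; apply: prodI_mem => //; apply: span_mem.
by rewrite adds_span //; apply: prodI_subr; apply: ideal_span.
Qed.

(** Elements of [B] outside the current ideal are adjoined one at a time; each lowers the remaining
    length by at least 1. *)
Lemma flen_gens A B : flen A B ->
  exists s, [/\ (size s <= len A B)%N, forall x, x \in s -> B x & B = adds A s].
Proof.
have [n] := ubnP (len A B); elim: n A => // n IH A lt fAB.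
have [iA iB AB _] := fAB.
case: (ssubI_or AB) => [<-|[_ nBA]]; first by exists [::].
have [x [Bx nAx]] : exists x, B x /\ ~ A x.
  apply: NNPP => N; apply: nBA => x Bx; apply: NNPP => nAx; apply: N.
  by exists x.
have iA' : ideal (addx A x (@fullI R)) by apply: ideal_addx.
have AA' : subI A (addx A x (@fullI R)) by apply: addx_l.
have A'x : addx A x (@fullI R) x by apply: addx_x.
have A'B : subI (addx A x (@fullI R)) B.
  by apply: addx_min => // b _; apply: idealMr.
have f1 := flen_l fAB iA' AA' A'B; have f2 := flen_r fAB iA' AA' A'B.
have E := len_add f1 f2.
have pos : (1 <= len A (addx A x (@fullI R)))%N.
  apply: len_chain => //; apply: (chainS iA _ (chain0 iA')).
  by split=> // /(_ _ A'x).
have [|s [sz sB EB]] := IH (addx A x (@fullI R)) _ f2; first by lia.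
exists (x :: s); split=> //; first by rewrite E (leq_add pos sz).
by move=> y; rewrite inE => /orP[/eqP ->|/sB].
Qed.

End Products.

(** * Noetherian local rings *)

Section Noetherian.
Variable R : comNzRingType.
Hypothesis noethR : noetherian R.
Implicit Types A B C K L : R -> Prop.

Lemma noeth_span K : ideal K -> exists s, K = span s.
Proof. by case/noethR => s /eqI_eq ->; exists s. Qed.

Lemma noeth_acc (f : nat -> R -> Prop) : (forall n, ideal (f n)) ->
  (forall n, subI (f n) (f n.+1)) -> exists N, forall n, (N <= n)%N -> f n = f N.
Proof.
move=> idf up.
have upl a b : (a <= b)%N -> subI (f a) (f b).
  by move=> /subnKC <-; elim: (b - a)%N => [|k IH]; rewrite ?addn0 // addnS;
     apply: subI_trans (up _).
have iU : ideal (fun x => exists n, f n x).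
  split; first by exists 0%N; apply: ideal0.
  split=> [x y [a fx] [b fy]|r x [a fx]]; last by exists a; apply: idealMl.
  exists (maxn a b); apply: idealD => //.
    by apply: upl fx; apply: leq_maxl.
  by apply: upl fy; apply: leq_maxr.
have [s Es] := noeth_span iU.
have [N HN] : exists N, forall x, x \in s -> f N x.
  have : forall x, x \in s -> exists n, f n x.
    by move=> x xs; rewrite -[exists n, _]/((fun x => exists n, f n x) x) Es; apply: span_mem.
  elim: s {Es} => [|x s IH] H; first by exists 0%N.
  have [|N HN] := IH; first by move=> y ys; apply: H; rewrite inE ys orbT.
  have [M HM] := H x (mem_head _ _).
  exists (maxn M N) => y; rewrite inE => /orP[/eqP ->|/HN].
    by apply: upl HM; apply: leq_maxl.
  by apply: upl; apply: leq_maxr.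
exists N => n Nn; apply: subI_antisym; last exact: upl.
move=> x fx; have : span s x by rewrite -Es; exists n.
exact: (span_min (idf N) HN).
Qed.

(** If [P K] failed, choice would turn the step into a strictly ascending sequence of
    counterexamples, against [noeth_acc]. *)
Lemma noeth_ind (P : (R -> Prop) -> Prop) :
  (forall K, ideal K -> (forall L, ideal L -> ssubI K L -> P L) -> P K) ->
  forall K, ideal K -> P K.
Proof.
move=> step K iK; apply: NNPP => nPK.
have next (x : {K | ideal K /\ ~ P K}) :
    {y : {K | ideal K /\ ~ P K} | ssubI (sval x) (sval y)}.
  apply: constructive_indefinite_description.
  case: x => A [iA nPA] /=; apply: NNPP => N; apply: nPA; apply: step => // L iL sL.
  by apply: NNPP => nPL; apply: N; exists (exist _ L (conj iL nPL)).
pose g n := iter n (fun x => sval (next x)) (exist _ K (conj iK nPK)).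
have gS n : ssubI (sval (g n)) (sval (g n.+1)) by exact: (svalP (next (g n))).
have [||N /(_ N.+1 (leqnSn _)) E] := @noeth_acc (fun n => sval (g n)).
- by move=> n; case: (svalP (g n)).
- by move=> n; case: (gS n).
by case: (gS N) => _; rewrite E; apply.
Qed.

Lemma nuP K : ideal K -> mingens_is K (nu K).
Proof.
move=> iK; have [s Es] := noeth_span iK.
suff ex : exists k, mingens_is K k by exact: (epsilon_spec (inhabits 0%N) _ ex).
have [k] := ubnP (size s); elim: k s Es => // k IH s Es lt.
case: (classic (exists t, K = span t /\ (size t < size s)%N)) => [[t [Et lt']]|N].
  by apply: (IH t Et); apply: leq_trans lt' _; rewrite -ltnS.
exists (size s); split; first by exists s; split=> // x; rewrite {1}Es.
move=> t /eqI_eq Et; rewrite leqNgt; apply/negP => lt'.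
by apply: N; exists t.
Qed.

Lemma nu_span K : ideal K -> exists s, size s = nu K /\ K = span s.
Proof. by move/nuP => [[s [sz /eqI_eq E]] _]; exists s. Qed.

Lemma len_prod_nu C K : flen C (@fullI R) -> ideal K ->
  flen (prodI C K) K /\ (len (prodI C K) K <= nu K * len C (@fullI R))%N.
Proof.
by move=> fC /nu_span[s [<- ->]]; apply: len_prod_span.
Qed.

Variable m : R -> Prop.
Hypothesis locR : local_with m.

Lemma ideal_max : ideal m. Proof. by case: locR => -[]. Qed.

Lemma max_proper : ~ m 1. Proof. by case: locR => -[_ []]. Qed.

Lemma max_max K : ideal K -> subI m K -> ~ K 1 -> K = m.
Proof. by case: locR => -[_ [_ mx]] _ iK mK K1; apply: subI_antisym => //; apply: mx. Qed.

(** By noetherian induction: a proper ideal with no proper ideal strictly above it is maximal, hence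
    equal to [m]. *)
Lemma proper_sub_max K : ideal K -> ~ K 1 -> subI K m.
Proof.
move=> iK; move: K iK; apply: noeth_ind => K iK IH K1.
case: (classic (exists L, [/\ ideal L, ssubI K L & ~ L 1])) => [[L [iL sL L1]]|N].
  by apply: subI_trans (IH L iL sL L1); case: sL.
case: locR => _ /(_ K) H; suff /H /eqI_eq -> : maximal_ideal K by [].
split=> //; split=> // L iL KL L1; apply: NNPP => nLK; apply: N.
by exists L.
Qed.

Lemma unit_notin x : ~ m x -> exists u, u * x = 1.
Proof.
move=> nmx; apply: NNPP => N; apply: nmx.
apply: (@proper_sub_max (span [:: x])); first exact: ideal_span.
  rewrite span_cons span_nil => -[_ [b [-> _ E]]]; apply: N; exists b.
  by rewrite mulrC E add0r.
by apply: span_mem; rewrite mem_head.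
Qed.

Lemma unit_1m a : m a -> exists u, u * (1 - a) = 1.
Proof.
move=> ma; apply: unit_notin => m1; apply: max_proper.
by have := idealD ideal_max m1 ma; rewrite subrK.
Qed.

Lemma prime_max : prime_ideal m.
Proof.
split; first exact: ideal_max.
split=> [|a b mab]; first exact: max_proper.
case: (classic (m a)) => ma; [by left | right].
have [u E] := unit_notin ma.
have -> : b = u * (a * b) by rewrite mulrA E mul1r.
by apply: idealMl => //; apply: ideal_max.
Qed.

Lemma len_max : flen m (@fullI R) /\ len m (@fullI R) = 1%N.
Proof.
have im := ideal_max.
have bd l : chain m (@fullI R) l -> (l <= 1)%N.
  move=> c; inversion c as [|X A' Y k _ [mA' nA'm] c'] => //.
  suff : k = 0%N by move=> ->.
  have [iA' _ A'f] := chain_ideal c'.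
  have A'1 : A' 1.
    by apply: NNPP => A'1; apply: nA'm; rewrite (max_max iA' mA' A'1).
  have EA' := ideal1 iA' A'1; rewrite EA' in c'.
  inversion c' as [|X' A'' Y' k' _ [_ nn] c''] => //.
  by case: nn.
have f : flen m (@fullI R) by split=> //; exists 1%N.
split=> //; apply/eqP; rewrite eqn_leq; apply/andP; split; first exact: len_le.
apply: len_chain => //; apply: (chainS im _ (chain0 (ideal_full R))).
by split=> // /(_ 1 I); apply: max_proper.
Qed.

(** The generators [zs] of [K] are taken relative to [L], so that induction can absorb one of them
    into [L] and then remove it again. *)
Lemma nakayama L K zs : ideal L -> ideal K -> (forall z, z \in zs -> K z) ->
  subI K (adds L zs) -> subI K (addx L 1 (prodI m K)) -> subI K L.
Proof.
move=> iL iK; elim: zs L iL => [//|z zs IH] L iL zK Kz KL.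
have iL' : ideal (addx L z (@fullI R)) by apply: ideal_addx.
have KL' : subI K (addx L z (@fullI R)).
  apply: IH => //; first by move=> y ys; apply: zK; rewrite inE ys orbT.
  by apply: subI_trans KL _; apply: addx_mono => //; apply: addx_l.
have iLz : ideal (addx L z m) by apply: ideal_addx => //; apply: ideal_max.
have Kz' : K z by apply: zK; rewrite mem_head.
(* As [K] lies in [L + (z)], the product [m K] lies in [L + z m]. So [z = a + z b] with [b] in [m],
   and [1 - b] is a unit. *)
have [a [b [La mb E]]] : addx L z m z.
  move: (KL _ Kz'); apply: addx_min => //.
    by apply: addx_l; apply: ideal_max.
  move=> w; rewrite mul1r; apply: prodI_min => // c d mc /KL' [l [r [Ll _ ->]]].
  exists (c * l), (c * r); split; first exact: idealMl.
    by apply: idealMr => //; apply: ideal_max.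
  by ring.
have Lz : L z.
  have [u Eu] := unit_1m mb.
  have -> : z = u * a.
    have -> : a = z * (1 - b) by rewrite mulrBr mulr1 {1}E addrK.
    by rewrite mulrCA Eu mulr1.
  exact: idealMl.
by apply: subI_trans KL' _; apply: addx_min => // b' _; apply: idealMr.
Qed.

(** One inequality is the length bound with [R / m] of length 1. For the other, [flen_gens] yields
    few elements generating [K] modulo [m K], and Nakayama makes them generate [K]. *)
Lemma nu_len K : ideal K -> nu K = len (prodI m K) K.
Proof.
move=> iK; have [fm lm] := len_max.
have [f le] := len_prod_nu fm iK; rewrite lm muln1 in le.
apply/eqP; rewrite eqn_leq le andbT.
have [s [sz sK EK]] := flen_gens f.
apply: leq_trans sz; have [_ mn] := nuP iK; apply: mn.
have -> : K = span s; last by [].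
have [zs Ez] := noeth_span iK.
apply: subI_antisym; last exact: span_min.
apply: (@nakayama _ _ zs) => //; first exact: ideal_span.
- by move=> z zin; rewrite Ez; apply: span_mem.
- rewrite {1}Ez; apply: span_min => [|x]; first exact: ideal_adds (ideal_span _).
  by apply: adds_mem; apply: ideal_span.
have iP := ideal_prodI m K.
rewrite {1}EK; apply: adds_min.
- by apply: ideal_addx => //; apply: ideal_span.
- by move=> x Px; rewrite -[x]mul1r; apply: addx_r => //; apply: ideal_span.
by move=> x xs; apply: addx_l => //; apply: span_mem.
Qed.

End Noetherian.

(** * Hilbert basis theorem and stable filtrations *)

Section HilbertBasis.
Variable T : comNzRingType.
Hypothesis noethT : noetherian T.

(** The ideal of leading coefficients in degree [n]; polynomials of smaller degree are allowed and
    contribute 0. *)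
Definition lcI (I : {poly T} -> Prop) (n : nat) : T -> Prop :=
  fun a => exists p, [/\ I p, (size p <= n.+1)%N & p`_n = a].

Lemma ideal_lcI I n : ideal I -> ideal (lcI I n).
Proof.
move=> iI; split; first by exists 0; rewrite coef0 size_poly0; split=> //; apply: ideal0.
split=> [a b [p [Ip sp <-]] [q [Iq sq <-]]|r a [p [Ip sp <-]]].
  exists (p + q); rewrite coefD; split=> //; first exact: idealD.
  by apply: leq_trans (size_polyD _ _) _; rewrite geq_max sp sq.
exists (r *: p); rewrite coefZ; split=> //.
  by rewrite -mul_polyC; apply: idealMl.
exact: leq_trans (size_scale_leq _ _) sp.
Qed.

Lemma lcI_S I n : ideal I -> subI (lcI I n) (lcI I n.+1).
Proof.
move=> iI a [p [Ip sp <-]]; exists (p * 'X); rewrite coefMX; split=> //.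
  exact: idealMr.
by apply: leq_trans (size_polyMleq _ _) _; rewrite size_polyX; lia.
Qed.

Lemma lcI_le I n k : ideal I -> (n <= k)%N -> subI (lcI I n) (lcI I k).
Proof.
move=> iI /subnKC <-; elim: (k - n)%N => [|j IH]; first by rewrite addn0; apply: subI_refl.
by rewrite addnS; apply: subI_trans IH (lcI_S iI).
Qed.

Lemma lcI_mono I K n : subI I K -> subI (lcI I n) (lcI K n).
Proof. by move=> IK a [p [/IK Kp sp E]]; exists p. Qed.

Lemma lcI_lift I n : ideal I -> exists G : seq {poly T},
  (forall g, g \in G -> I g) /\ subI (lcI I n) (lcI (span G) n).
Proof.
move=> iI; have [s Es] := noeth_span noethT (ideal_lcI n iI).
have H0 a : a \in s -> lcI I n a by rewrite Es; apply: span_mem.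
rewrite Es; elim: s {Es} H0 => [|a s IH] H.
  exists [::]; split=> //; apply: span_min => //.
  by apply: ideal_lcI; apply: ideal_span.
have [|G [GI sG]] := IH; first by move=> b bs; apply: H; rewrite inE bs orbT.
have [p [Ip sp Ep]] := H a (mem_head _ _).
exists (p :: G); split=> [g|]; first by rewrite inE => /orP[/eqP ->|/GI].
apply: span_min => [|b]; first by apply: ideal_lcI; apply: ideal_span.
rewrite inE => /orP[/eqP ->|bs].
  by exists p; split=> //; apply: span_mem; rewrite mem_head.
apply: (@lcI_mono (span G)); last by apply: sG; apply: span_mem.
by apply: span_subseq => x xG; rewrite inE xG orbT.
Qed.

Lemma lcI_lifts I N : ideal I -> exists G : seq {poly T},
  (forall g, g \in G -> I g) /\
  forall n, (n <= N)%N -> subI (lcI I n) (lcI (span G) n).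
Proof.
move=> iI; elim: N => [|N [G [GI sG]]].
  by have [G [GI sG]] := lcI_lift 0 iI; exists G; split=> // n; rewrite leqn0 => /eqP ->.
have [H [HI sH]] := lcI_lift N.+1 iI.
exists (G ++ H); split=> [g|n]; first by rewrite mem_cat => /orP[/GI|/HI].
rewrite leq_eqVlt => /orP[/eqP ->|]; last rewrite ltnS => /sG {}sG.
  apply: subI_trans sH _; apply: lcI_mono; apply: span_subseq => x xH.
  by rewrite mem_cat xH orbT.
apply: subI_trans sG _; apply: lcI_mono; apply: span_subseq => x xH.
by rewrite mem_cat xH.
Qed.

Theorem hilbert_basis : noetherian {poly T}.
Proof.
move=> I iI.
have [N HN] := noeth_acc noethT (fun n => ideal_lcI n iI) (fun n => lcI_S (n := n) iI).
have [G [GI sG]] := lcI_lifts N iI.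
exists G; suff -> : I = span G by [].
have iG := ideal_span G.
apply: subI_antisym; last exact: span_min.
suff H k (p : {poly T}) : (size p <= k)%N -> I p -> span G p by move=> p; apply: (H (size p)).
elim: k p => [p|k IH p sp Ip].
  by rewrite leqn0 size_poly_eq0 => /eqP -> _; apply: ideal0.
(* Subtracting a suitable [g] from the span cancels the coefficient of degree [k]. Beyond [N] the
   ideals [lcI I k] are stationary, and [lcI_le] raises a polynomial of degree at most [N] to degree
   [k]. *)
have [g [Gg sg Eg]] : lcI (span G) k p`_k.
  have Lp : lcI I k p`_k by exists p.
  case: (leqP k N) => kN; first exact: sG.
  apply: (lcI_le iG (ltnW kN)); apply: sG => //.
  by rewrite -(HN k (ltnW kN)).
rewrite -[p](subrK g); apply: (idealD iG) => //.
have Ig : I g by apply: (span_min iI GI).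
apply: IH; last exact: idealB.
apply/leq_sizeP => j; rewrite leq_eqVlt => /orP[/eqP <-|kj].
  by rewrite coefB Eg subrr.
by rewrite coefB !nth_default ?subr0 //; [apply: leq_trans sg kj | apply: leq_trans sp kj].
Qed.
End HilbertBasis.

(** * The Rees algebra and stability of its graded ideals *)

Section Rees.
Variable R : comNzRingType.
Hypothesis noethR : noetherian R.
Variable J : R -> Prop.

(** Membership in the Rees algebra, the direct sum of the [J^n X^n] inside [R[X]]. *)
Definition in_rees (f : {poly R}) := forall n, powI J n f`_n.

Lemma in_reesD f g : in_rees f -> in_rees g -> in_rees (f + g).
Proof. by move=> Jf Jg n; rewrite coefD; apply: (idealD (ideal_powI J n)). Qed.

Lemma in_reesM f g : in_rees f -> in_rees g -> in_rees (f * g).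
Proof.
move=> Jf Jg n; rewrite coefM; apply: (ideal_sum _ (ideal_powI J n)) => i _.
rewrite -{1}(subnKC (ltn_ord i : (i <= n)%N)) -powID.
exact: prodI_mem.
Qed.

Lemma in_reesC a : in_rees a%:P.
Proof.
by case=> [//|n]; rewrite coefC /=; apply: (ideal0 (ideal_powI J n.+1)).
Qed.

(** One polynomial variable is added per generator [x] and sent to [x X]; the Hilbert basis theorem
    keeps the source noetherian. Ideals of the Rees algebra are then studied through their preimages
    in [P]. *)
Lemma rees_cover (s : seq R) : (forall x, x \in s -> J x) ->
  exists (P : comNzRingType) (phi : {rmorphism P -> {poly R}}),
  [/\ noetherian P, forall r, exists p, phi p = r%:P,
      forall x, x \in s -> exists p, phi p = x *: 'X & forall p, in_rees (phi p)].
Proof.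
elim: s => [|x s IH] sJ.
  exists R, (polyC : {rmorphism R -> {poly R}}); split=> // [r|]; first by exists r.
  exact: in_reesC.
have [|P [phi [nP hC hX hJ]]] := IH; first by move=> y ys; apply: sJ; rewrite inE ys orbT.
exists {poly P}.
exists ((horner_eval (x *: 'X) \o map_poly phi) : {rmorphism {poly P} -> {poly R}}).
have E p : (horner_eval (x *: 'X) \o map_poly phi) p%:P = phi p.
  by rewrite /= /horner_eval map_polyC hornerC.
split; first exact: hilbert_basis.
- by move=> r; have [p Ep] := hC r; exists p%:P; rewrite -Ep; apply: E.
- move=> y; rewrite inE => /orP[/eqP ->|/hX[p Ep]]; last by exists p%:P; rewrite -Ep; apply: E.
  by exists 'X; rewrite /= /horner_eval map_polyX hornerX.
move=> p; rewrite /= /horner_eval horner_coef.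
apply: (big_ind in_rees); [exact: in_reesC | exact: in_reesD | move=> i _].
rewrite coef_map; apply: in_reesM; first exact: hJ.
elim: (i : nat) => [|k IHk]; first by rewrite expr0; apply: in_reesC.
rewrite exprS; apply: in_reesM => //.
case=> [|[|n]]; rewrite coefZ coefX /= ?mulr0 ?mulr1.
- by [].
- have Jx : J x by apply: sJ; rewrite mem_head.
  by rewrite -[x]mulr1; apply: prodI_mem.
exact: (ideal0 (ideal_powI J n.+2)).
Qed.

Hypothesis iJ : ideal J.

(* A family [A_n] of this shape is a graded ideal of the Rees algebra, which is
   a quotient of a polynomial ring over [R]; finite generation gives stability. *)
Lemma rees_stable (A : nat -> R -> Prop) : (forall n, ideal (A n)) ->
  (forall n, subI (A n) (powI J n)) ->
  (forall n j a, J j -> A n a -> A n.+1 (j * a)) ->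
  exists N, forall n, (N <= n)%N -> A n.+1 = prodI J (A n).
Proof.
move=> iA AJ JA.
have [s Es] := noeth_span noethR iJ.
have [|P [phi [nP hC hX hJ]]] := @rees_cover s; first by rewrite Es; apply: span_mem.
have cover n a : powI J n a -> exists p, phi p = a *: 'X^n.
  elim: n a => [|n IH] a /=; first by have [p Ep] := hC a; exists p; rewrite Ep expr0 alg_polyC.
  have iT k : ideal (fun a => exists p, phi p = a *: 'X^k).
    split; first by exists 0; rewrite rmorph0 scale0r.
    split=> [b c [p Ep] [q Eq]|r b [p Ep]].
      by exists (p + q); rewrite rmorphD Ep Eq scalerDl.
    have [q Eq] := hC r; exists (q * p).
    by rewrite rmorphM Ep Eq mul_polyC scalerA.
  move: a; apply: (prodI_min (iT n.+1)) => j b Jj /IH[p Ep].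
  have [q Eq] : exists q, phi q = j *: 'X^1.
    move: j Jj; rewrite {1}Es; apply: (span_min (iT 1%N)) => x /hX[q Eq].
    by exists q; rewrite expr1.
  exists (q * p); rewrite rmorphM Ep Eq -scalerAl -scalerAr scalerA.
  by rewrite -exprD.
have JAk k n : forall j a, powI J k j -> A n a -> A (k + n)%N (j * a).
  elim: k => [|k IH] j a; first by move=> _; apply: idealMl.
  move=> /= Jj Aa; have iT : ideal (fun j => A (k.+1 + n)%N (j * a)).
    split; first by rewrite mul0r; apply: ideal0.
    split=> [u v ? ?|r u ?]; first by rewrite mulrDl; apply: (idealD (iA _)).
    by rewrite -mulrA; apply: (idealMl _ (iA _)).
  move: j Jj; apply: (prodI_min iT) => u v Ju Jv.
  by rewrite -mulrA addSn; apply: JA => //; apply: IH.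
have JPk k n : forall j a, powI J k j -> prodI J (A n) a -> prodI J (A (k + n)%N) (j * a).
  move=> j a Jj; have iP := ideal_prodI J (A (k + n)%N).
  have iT : ideal (fun a => prodI J (A (k + n)%N) (j * a)).
    split; first by rewrite mulr0; apply: (ideal0 iP).
    split=> [u v ? ?|r u ?]; first by rewrite mulrDr; apply: (idealD iP).
    by rewrite mulrCA; apply: (idealMl _ iP).
  move: a; apply: (prodI_min iT) => u v Ju Av.
  by rewrite mulrCA; apply: prodI_mem => //; apply: JAk.
(* The preimage in [P] of the graded ideal with components [A n]. *)
pose M (p : P) := forall n, A n (phi p)`_n.
have iM : ideal M.
  split; first by move=> n; rewrite rmorph0 coef0; apply: ideal0.
  split=> [p q Mp Mq n|q p Mp n]; first by rewrite rmorphD coefD; apply: (idealD (iA n)).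
  rewrite rmorphM coefM; apply: (ideal_sum _ (iA n)) => i _.
  rewrite -{1}(subnKC (ltn_ord i : (i <= n)%N)).
  by apply: JAk; [apply: hJ | apply: Mp].
have [ps Eps] := noeth_span nP iM.
have [N HN] : exists N, forall p, p \in ps -> (size (phi p) <= N)%N.
  exists (\max_(p <- ps) size (phi p)) => p pps.
  by rewrite (big_rem p pps) /= leq_maxl.
(* The generators [ps] lie in [M'] because their images have no coefficient in degree above [N].
   Once [M'] is an ideal, it is all of [M]. *)
pose M' (p : P) := M p /\ forall n, (N <= n)%N -> prodI J (A n) (phi p)`_n.+1.
have iM' : ideal M'.
  split.
    split; first exact: (ideal0 iM).
    by move=> n _; rewrite rmorph0 coef0; apply: (ideal0 (ideal_prodI _ _)).
  split=> [p q [Mp Mp'] [Mq Mq']|q p [Mp Mp']].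
    split=> [|n Nn]; first exact: (idealD iM).
    by rewrite rmorphD coefD; apply: (idealD (ideal_prodI _ _)); [apply: Mp' | apply: Mq'].
  split=> [|n Nn]; first exact: (idealMl q iM).
  rewrite mulrC rmorphM coefM; apply: (ideal_sum _ (ideal_prodI _ _)) => i _.
  case: i => i /= lti; rewrite mulrC.
  (* If [i > N], the factor from [p] already lies in [J A_(i-1)]. Otherwise [i <= N <= n], so the
     factor from [q] has positive degree and supplies the element of [J]. *)
  case: (ltnP N i) => iN.
    case: i lti iN => // i lti iN.
    have -> : A n = A (n.+1 - i.+1 + i)%N by congr (A _); lia.
    by apply: JPk; [apply: hJ | apply: Mp'; rewrite -ltnS].
  have : powI J (n - i).+1 (phi q)`_(n.+1 - i).
    have -> : ((n - i).+1 = n.+1 - i)%N by lia.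
    exact: hJ.
  move: (phi q)`_(n.+1 - i) => b /= Jb.
  have -> : A n = A ((n - i) + i)%N by congr (A _); lia.
  set c := (phi p)`_i.
  have iP := ideal_prodI J (A (n - i + i)%N).
  have iT : ideal (fun b => prodI J (A (n - i + i)%N) (b * c)).
    split; first by rewrite mul0r; apply: (ideal0 iP).
    split=> [u v ? ?|r u ?]; first by rewrite mulrDl; apply: (idealD iP).
    by rewrite -mulrA; apply: (idealMl _ iP).
  move: b Jb; apply: (prodI_min iT) => u v Ju Jv.
  rewrite -mulrA; apply: prodI_mem => //.
  by apply: JAk => //; apply: Mp.
exists N => n Nn; apply: subI_antisym; last by apply: prodI_min => // j a; apply: JA.
move=> a Aa; have [p Ep] := cover _ _ (AJ _ _ Aa).
have : M p.
  move=> k; rewrite Ep coefZ coefXn; case: eqP => [->|_]; first by rewrite mulr1.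
  by rewrite mulr0; apply: ideal0.
rewrite Eps => /(span_min iM')[].
  move=> q qps; split; first by rewrite Eps; apply: span_mem.
  move=> k Nk; rewrite nth_default; first exact: (ideal0 (ideal_prodI _ _)).
  by apply: leq_trans (HN _ qps) _; lia.
by move=> _ /(_ n Nn); rewrite Ep coefZ coefXn eqxx mulr1.
Qed.

End Rees.

(** * Hilbert functions *)

Section EventuallyPolynomial.
Implicit Types (c e : nat -> int) (u v : nat -> int).

(** In this basis differences only shift [c], so coefficients stay integral, and the last one is the
    normalized leading coefficient. *)
Definition binpoly k c n : int := \sum_(j < k) c j * ('C(n + j, j))%:Z.

(** Formal degree less than [k]; for [k = 0] the function is eventually zero. *)
Definition evpoly k u := exists c N, forall n, (N <= n)%N -> u n = binpoly k c n.

Lemma binpolyS k c n :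
  binpoly k.+1 c n = binpoly k c n + c k * ('C(n + k, k))%:Z.
Proof. by rewrite /binpoly big_ord_recr. Qed.

Lemma binpoly_diff k c n :
  binpoly k.+1 c n.+1 - binpoly k.+1 c n = binpoly k (fun j => c j.+1) n.+1.
Proof.
rewrite /binpoly !big_ord_recl /= !bin0 opprD addrACA subrr add0r -sumrB.
apply: eq_bigr => i _; rewrite /bump /= !add1n !addnS !addSn binS PoszD.
by ring.
Qed.

Lemma eq_binpoly k c e n : (forall j, (j < k)%N -> c j = e j) ->
  binpoly k c n = binpoly k e n.
Proof. by move=> E; apply: eq_bigr => j _; rewrite E. Qed.

Lemma binpolyD k c e n :
  binpoly k (fun j => c j + e j) n = binpoly k c n + binpoly k e n.
Proof. by rewrite /binpoly -big_split; apply: eq_bigr => j _; rewrite mulrDl. Qed.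

Lemma binpolyN k c n : binpoly k (fun j => - c j) n = - binpoly k c n.
Proof. by rewrite /binpoly -sumrN; apply: eq_bigr => j _; rewrite mulNr. Qed.

Lemma binpolyB k c e n :
  binpoly k (fun j => c j - e j) n = binpoly k c n - binpoly k e n.
Proof. by rewrite binpolyD binpolyN. Qed.

Lemma binpolyZ k c a n : binpoly k (fun j => a * c j) n = a * binpoly k c n.
Proof. by rewrite /binpoly mulr_sumr; apply: eq_bigr => j _; rewrite mulrA. Qed.

Lemma binpoly_pad k l c n : (k <= l)%N ->
  binpoly l (fun j => if (j < k)%N then c j else 0) n = binpoly k c n.
Proof.
move=> /subnKC <-; elim: (l - k)%N => [|i IH].
  by rewrite addn0; apply: eq_binpoly => j ->.
by rewrite addnS binpolyS IH ltnNge leq_addr /= mul0r addr0.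
Qed.

(** This is the value at [n + 1] minus the difference, rewritten in the basis at [n + 1]; the top
    coefficient does not change. *)
Lemma binpoly_shift k c n : binpoly k.+1 c n =
  binpoly k.+1 (fun j => c j - (if (j < k)%N then c j.+1 else 0)) n.+1.
Proof.
rewrite binpolyB (binpoly_pad (fun j => c j.+1) _ (leqnSn k)).
by rewrite -binpoly_diff; ring.
Qed.

(** By induction the difference is eventually at least 1, so the values grow at least linearly and
    outrun the starting value [b]. *)
Lemma binpoly_gt0 k c : 0 < c k ->
  exists N, forall n, (N <= n)%N -> 0 < binpoly k.+1 c n.
Proof.
elim: k c => [|k IH] c ck.
  by exists 0%N => n _; rewrite /binpoly big_ord1 bin0 mulr1.
have [N HN] := IH (fun j => c j.+1) ck.
pose b := binpoly k.+2 c N.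
have lin t : b + t%:Z <= binpoly k.+2 c (N + t).
  elim: t => [|t IHt]; first by rewrite addr0 addn0.
  have := HN (N + t).+1 (leqW (leq_addr _ _)).
  by rewrite -binpoly_diff addnS; lia.
exists (N + (`|b|%N).+1)%N => n Nn.
have := lin (n - N)%N; rewrite subnKC; last by lia.
by lia.
Qed.

Lemma binpoly_le0 k c N : (forall n, (N <= n)%N -> binpoly k.+1 c n <= 0) -> c k <= 0.
Proof.
move=> H; rewrite leNgt; apply/negP => /binpoly_gt0[M HM].
have := HM _ (leq_maxr N M); have := H _ (leq_maxl N M); lia.
Qed.

Lemma evpoly_sub k u v : evpoly k u -> evpoly k v -> evpoly k (fun n => u n - v n).
Proof.
move=> [c [N Hc]] [e [M He]]; exists (fun j => c j - e j), (maxn N M) => n.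
by rewrite geq_max => /andP[/Hc -> /He ->]; rewrite binpolyB.
Qed.

Lemma evpoly_shift k u : evpoly k u -> evpoly k (fun n => u n.-1).
Proof.
move=> [c [N Hc]]; case: k c Hc => [|k] c Hc.
  by exists c, N.+1 => -[//|n] Nn; rewrite Hc // /binpoly !big_ord0.
exists (fun j => c j - (if (j < k)%N then c j.+1 else 0)), N.+1 => -[//|n] Nn.
by rewrite -binpoly_shift Hc.
Qed.

(** Summation shifts the coefficients up by one place; the free constant term [b] is fitted at the
    single point [L]. *)
Lemma evpoly_sum k u v N : (forall n, (N <= n)%N -> u n.+1 - u n = v n.+1) ->
  evpoly k v -> evpoly k.+1 u.
Proof.
move=> uv [c [M Hc]]; pose L := maxn N M.
pose e b j := if j is j'.+1 then c j' else b.
have diff b n : binpoly k.+1 (e b) n.+1 - binpoly k.+1 (e b) n = binpoly k c n.+1.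
  by rewrite binpoly_diff.
have shiftb b n : binpoly k.+1 (e b) n = b + binpoly k.+1 (e 0) n.
  by rewrite /binpoly !big_ord_recl /= bin0 mulr1 mul0r add0r.
pose b := u L - binpoly k.+1 (e 0) L.
exists (e b), L => n /subnKC <-; elim: (n - L)%N => [|t IH].
  by rewrite addn0 shiftb /b; ring.
have LN : (N <= L + t)%N by rewrite /L; lia.
have LM : (M <= (L + t).+1)%N by rewrite /L; lia.
have := uv _ LN; rewrite (Hc _ LM) addnS -(diff b) IH; lia.
Qed.

Lemma evpoly_diff k u : evpoly k.+1 u -> evpoly k (fun n => u n - u n.-1).
Proof.
move=> [c [N Hc]]; exists (fun j => c j.+1), N.+1 => -[//|n] Nn.
by rewrite /= -binpoly_diff !Hc // ltnW.
Qed.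

(** While [k] exceeds [l], the top coefficient of [u] is at most 0 by comparison with [v] and at
    least 0 by positivity, so it vanishes and [k] drops. *)
Lemma evpoly_bound k l u v N : evpoly k u -> evpoly l v ->
  (forall n, (N <= n)%N -> 0 <= u n <= v n) -> evpoly l u.
Proof.
move=> eu [e [M He]] uv; elim: k eu => [|k IH] [c [L Hc]].
  exists (fun=> 0), L => n /Hc ->.
  by rewrite /binpoly big_ord0 big1 // => j _; rewrite mul0r.
case: (ltnP k l) => kl.
  exists (fun j => if (j < k.+1)%N then c j else 0), L => n /Hc ->.
  by rewrite binpoly_pad.
pose N' := maxn N (maxn M L).
have ck1 : c k <= 0.
  have := @binpoly_le0 k (fun j => c j - if (j < l)%N then e j else 0) N'.
  rewrite ltnNge kl /= subr0; apply => n Nn.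
  rewrite binpolyB binpoly_pad; last by lia.
  have /Hc <- : (L <= n)%N by rewrite /N' in Nn; lia.
  have /He <- : (M <= n)%N by rewrite /N' in Nn; lia.
  have /uv : (N <= n)%N by rewrite /N' in Nn; lia.
  by lia.
have ck2 : - c k <= 0.
  apply: (@binpoly_le0 k (fun j => - c j) N') => n Nn; rewrite binpolyN.
  have /Hc <- : (L <= n)%N by rewrite /N' in Nn; lia.
  have /uv : (N <= n)%N by rewrite /N' in Nn; lia.
  by lia.
have c0 : c k = 0 by lia.
apply: IH; exists c, L => n /Hc ->.
by rewrite binpolyS c0 mul0r addr0.
Qed.

End EventuallyPolynomial.

(** * The Hilbert-Serre theorem *)

Section HilbertSerre.
Variable R : comNzRingType.
Hypothesis noethR : noetherian R.
Variable J : R -> Prop.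
Hypothesis iJ : ideal J.

(** The [A n] form a graded module over the Rees algebra. Equality of [A n.+1] with [J A n] is not
    demanded; for large [n] it comes from [rees_stable]. *)
Definition stable (A : nat -> R -> Prop) :=
  (forall n, ideal (A n)) /\ (forall n j a, J j -> A n a -> A n.+1 (j * a)).

(* The pair [B_n <= A_n] encodes the graded module with components [A_n / B_n];
   the last hypothesis says that it is a module over the subalgebra generated
   by [xs]. *)
Theorem hilbert_serre (xs : seq R) (A B : nat -> R -> Prop) :
  stable A -> stable B -> (forall n, subI (A n) (powI J n)) ->
  (forall n, flen (B n) (A n)) -> (forall x, x \in xs -> J x) ->
  (forall j, J j -> exists c, span xs c /\
     forall n a, A n a -> B n.+1 ((j - c) * a)) ->
  evpoly (size xs) (fun n => (len (B n) (A n))%:Z).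
Proof.
elim: xs A B => [|x xs IH] A B sA sB AJ fBA xsJ gen_xs.
  (* Without generators [J A_n] lies in [B_(n+1)], while stability makes it equal to [A_(n+1)] for
     large [n]. *)
  have [N HN] := rees_stable noethR iJ (proj1 sA) AJ (proj2 sA).
  exists (fun=> 0), N.+1 => -[//|n] Nn; rewrite /binpoly big_ord0.
  have -> : A n.+1 = B n.+1.
    apply: subI_antisym; last by case: (fBA n.+1).
    rewrite HN //; apply: prodI_min => [|j a Jj Aa]; first exact: (proj1 sB).
    have [c [c0 H]] := gen_xs _ Jj; rewrite span_nil in c0.
    by have := H _ _ Aa; rewrite c0 subr0.
  by rewrite len_refl //; apply: (proj1 sB).
have [iA JA] := sA; have [iB JB] := sB.
have BA n : subI (B n) (A n) by case: (fBA n).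
have Jx : J x by apply: xsJ; rewrite mem_head.
have xsJ' y : y \in xs -> J y by move=> yxs; apply: xsJ; rewrite inE yxs orbT.
(* Multiplication by [x] on the module [A / B] has cokernel [A / C] and kernel [K / B]. Both are
   killed by [x], so induction on [xs] applies to them. *)
pose C n := if n is n'.+1 then addx (B n) x (A n') else B 0%N.
pose K n := pre (B n.+1) x (A n).
have iC n : ideal (C n) by case: n => [|n]; [apply: iB | apply: ideal_addx].
have BC n : subI (B n) (C n).
  by case: n => [|n]; [apply: subI_refl | apply: addx_l].
have CA n : subI (C n) (A n).
  case: n => [|n]; first exact: BA.
  by apply: addx_min => // a Aa; apply: JA.
have iK n : ideal (K n) by apply: ideal_pre.
have BK n : subI (B n) (K n) by move=> b Bb; split; [apply: BA | apply: JB].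
have KA n : subI (K n) (A n) by move=> a [].
have evC : evpoly (size xs) (fun n => (len (C n) (A n))%:Z).
  apply: IH => // [|n|j Jj].
  - split=> // -[|n] j b Jj.
      by move=> Bb; apply: BC; apply: JB.
    move=> [b0 [a [Bb Aa ->]]]; exists (j * b0), (j * a).
    by split; [apply: JB | apply: JA | ring].
  - exact: flen_r (fBA n) (iC n) (BC n) (CA n).
  have [c [sc H]] := gen_xs _ Jj; rewrite span_cons in sc.
  have [c' [r [sc' _ Ec]]] := sc; exists c'; split=> // n a Aa.
  exists ((j - c) * a), (r * a); split; first exact: H.
    exact: idealMl.
  by rewrite Ec; ring.
have evK : evpoly (size xs) (fun n => (len (B n) (K n))%:Z).
  apply: IH => // [|n|n|j Jj].
  - split=> // n j a Jj [Aa Bxa]; split; first exact: JA.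
    by rewrite mulrCA; apply: JB.
  - exact: subI_trans (KA n) (AJ n).
  - exact: flen_l (fBA n) (iK n) (BK n) (KA n).
  have [c [sc H]] := gen_xs _ Jj; rewrite span_cons in sc.
  have [c' [r [sc' _ Ec]]] := sc; exists c'; split=> // n a [Aa Bxa].
  have -> : (j - c') * a = (j - c) * a + r * (x * a) by rewrite Ec; ring.
  by apply: (idealD (iB _)); [apply: H | apply: (idealMl _ (iB _))].
(* The exact sequence of multiplication by [x] gives the difference of lengths in degrees [n + 1]
   and [n] as cokernel in degree [n + 1] minus kernel in degree [n]. *)
apply: (@evpoly_sum _ _ (fun n => (len (C n) (A n))%:Z - (len (B n.-1) (K n.-1))%:Z) 0%N);
  last exact: evpoly_sub evC (evpoly_shift evK).
move=> n _ /=.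
have f1 : flen (B n.+1) (C n.+1) by apply: flen_l (fBA n.+1) _ _ _.
have f2 : flen (C n.+1) (A n.+1) by apply: flen_r (fBA n.+1) _ _ _.
have f3 : flen (B n) (K n) by apply: flen_l (fBA n) _ _ _.
have f4 : flen (K n) (A n) by apply: flen_r (fBA n) _ _ _.
have E : len (B n.+1) (C n.+1) = len (K n) (A n) by apply: len_image_eq.
rewrite (len_add f1 f2) (len_add f3 f4) E !PoszD; ring.
Qed.

End HilbertSerre.

(** * Primary ideals and systems of parameters *)

Section Primes.
Variable R : comNzRingType.
Hypothesis noethR : noetherian R.
Implicit Types A B C K L P Q : R -> Prop.

Lemma nonprime K : ideal K -> ~ K 1 -> ~ prime_ideal K ->
  exists a b, [/\ K (a * b), ~ K a & ~ K b].
Proof.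
move=> iK K1 nP; apply: NNPP => N; apply: nP; split=> //; split=> // a b Kab.
case: (classic (K a)) => Ka; [by left | right].
by apply: NNPP => Kb; apply: N; exists a, b.
Qed.

Lemma ssubI_addx K a : ideal K -> ~ K a -> ssubI K (addx K a (@fullI R)).
Proof.
move=> iK nKa; split; first exact: addx_l.
by move=> /(_ a (addx_x a iK)).
Qed.

Lemma ssubI_pre K a b : ideal K -> K (a * b) -> ~ K b ->
  ssubI K (pre K a (@fullI R)).
Proof.
move=> iK Kab nKb; split; first by move=> x Kx; split=> //; apply: idealMl.
by move=> /(_ b) H; apply: nKb; apply: H.
Qed.

(** If [K] is not prime, some [a b] is in [K] with [a], [b] outside; every prime over [K] contains
    [a] or [b], so the lists for [K + (a)] and [K + (b)] are joined. The list stands in for the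
    minimal primes. *)
Lemma primes_over K : ideal K -> exists Ps : seq (R -> Prop),
  (forall P, List.In P Ps -> prime_ideal P /\ subI K P) /\
  (forall P, prime_ideal P -> subI K P ->
     exists P0, List.In P0 Ps /\ subI P0 P).
Proof.
move: K; apply: (noeth_ind noethR) => K iK IH.
case: (classic (K 1)) => K1.
  exists [::]; split=> // P [_ [P1 _]] KP; case: P1; exact: KP.
case: (classic (prime_ideal K)) => [pK|/(nonprime iK K1)[a [b [Kab nKa nKb]]]].
  exists [:: K]; split=> [P [<-|[]]|P _ KP]; first by split=> // x.
  by exists K; split=> //; left.
have [Ps [Ps1 Ps2]] := IH _ (ideal_addx a iK (ideal_full R)) (ssubI_addx iK nKa).
have [Qs [Qs1 Qs2]] := IH _ (ideal_addx b iK (ideal_full R)) (ssubI_addx iK nKb).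
exists (Ps ++ Qs); split=> [P|P pP KP].
  case/List.in_app_iff=> [/Ps1|/Qs1] [pP sub]; split=> //.
    exact: subI_trans (addx_l a (ideal_full R)) sub.
  exact: subI_trans (addx_l b (ideal_full R)) sub.
have [iP [_ /(_ a b (KP _ Kab))]] := pP.
have up x : P x -> subI (addx K x (@fullI R)) P.
  by move=> Px; apply: addx_min => // y _; apply: idealMr.
case=> /up; [case/(Ps2 _ pP) | case/(Qs2 _ pP)] => P0 [inP0 sP0]; exists P0.
  by split=> //; apply/List.in_app_iff; left.
by split=> //; apply/List.in_app_iff; right.
Qed.

(** In the nonprime case, powers of [x] lie in [K + (a)] and in [K + (b)], and the product of two
    such elements lies in [K] since [a b] does. *)
Lemma radical_sub K x : ideal K ->
  (forall P, prime_ideal P -> subI K P -> P x) -> exists n, K (x ^+ n).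
Proof.
move: K; apply: (noeth_ind noethR (P := fun K =>
  (forall P, prime_ideal P -> subI K P -> P x) -> exists n, K (x ^+ n))).
move=> K iK IH all_x.
case: (classic (K 1)) => K1; first by exists 0%N.
case: (classic (prime_ideal K)) => [pK|/(nonprime iK K1)[a [b [Kab nKa nKb]]]].
  by exists 1%N; rewrite expr1; apply: (all_x K).
have up c : ~ K c -> exists n, addx K c (@fullI R) (x ^+ n).
  move=> nKc; have [KC _] := ssubI_addx iK nKc.
  apply: IH; [exact: ideal_addx | exact: ssubI_addx | move=> P pP CP].
  by apply: all_x => //; apply: subI_trans KC CP.
have [n [u [r [Ku _ En]]]] := up a nKa; have [k [v [t [Kv _ Ek]]]] := up b nKb.
exists (n + k)%N; rewrite exprD En Ek.
have -> : (u + a * r) * (v + b * t) = (v + b * t) * u + (a * r) * v + (r * t) * (a * b).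
  by ring.
by apply: (idealD iK); [apply: (idealD iK)|]; apply: (idealMl _ iK).
Qed.

Lemma prime_avoidance J (Ps : seq (R -> Prop)) : ideal J ->
  (forall P, List.In P Ps -> prime_ideal P) ->
  exists x, J x /\ forall P, List.In P Ps -> subI J P \/ ~ P x.
Proof.
move=> iJ; have [n] := ubnP (size Ps); elim: n Ps => // n IH [|P Ps] /= lt pPs.
  by exists 0; split=> //; apply: ideal0.
have [|Q QPs|x [Jx Hx]] := IH Ps; [by lia | by apply: pPs; right |].
case: (classic (subI J P)) => JP.
  by exists x; split=> // Q [<-|/Hx]; [left|].
case: (classic (P x)) => Px; last by exists x; split=> // Q [<-|/Hx]; [right|].
have [iP [P1 Pab]] : prime_ideal P by apply: pPs; left.
(* If some [Q] lies inside [P], avoiding [P] avoids [Q], so [Q] is dropped. Otherwise [x] is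
   corrected by a [y] that lies in every [Q] but not in [P]. *)
case: (classic (exists Q, List.In Q Ps /\ subI Q P)) => [[Q [QPs QP]]|N].
  have [l1 [l2 E]] := List.in_split _ _ QPs; subst Ps.
  rewrite size_cat /= in lt.
  have [||y [Jy Hy]] := IH (P :: l1 ++ l2).
  - by rewrite /= size_cat; lia.
  - move=> P' /= [<-|/List.in_app_iff H]; apply: pPs; [by left | right].
    by apply/List.in_app_iff; case: H => ?; [left | right; right].
  have nPy : ~ P y by case: (Hy P (or_introl (erefl P))).
  exists y; split=> // P' [<-|/List.in_app_iff[H|[<-|H]]]; first by right.
  - by apply: Hy; right; apply/List.in_app_iff; left.
  - by right=> /QP.
  by apply: Hy; right; apply/List.in_app_iff; right.
have [j [Jj nPj]] : exists j, J j /\ ~ P j.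
  by apply: NNPP => N'; apply: JP => z Jz; apply: NNPP => nPz; apply: N'; exists z.
have [y [Jy nPy Hy]] : exists y, [/\ J y, ~ P y & forall Q, List.In Q Ps -> Q y].
  have pPs' Q : List.In Q Ps -> prime_ideal Q by move=> ?; apply: pPs; right.
  elim: Ps N pPs' {IH lt pPs Hx} => [|Q Ps IH] N pPs; first by exists j.
  have [||y [Jy nPy Hy]] := IH.
  - by move=> [Q' [? ?]]; apply: N; exists Q'; split=> //; right.
  - by move=> Q' ?; apply: pPs; right.
  have [z [Qz nPz]] : exists z, Q z /\ ~ P z.
    apply: NNPP => N'; apply: N; exists Q; split; first by left.
    by move=> z Qz; apply: NNPP => nPz; apply: N'; exists z.
  exists (z * y); split; [exact: idealMl | by case/Pab |].
  move=> Q' [<-|inQ']; first by apply: idealMr => //; case: (pPs Q (or_introl (erefl Q))).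
  by apply: idealMl (Hy _ inQ'); case: (pPs Q' (or_intror inQ')).
exists (x + y); split; first exact: idealD.
move=> Q [<-|QPs].
  by right=> Pxy; apply: nPy; have := idealB iP Pxy Px; rewrite addrAC subrr add0r.
case: (Hx Q QPs) => [JQ|nQx]; [by left | right=> Qxy].
apply: nQx; rewrite -(addrK y x); apply: idealB => //; last exact: Hy.
by case: (pPs Q (or_intror QPs)).
Qed.

(** * Primary ideals, parameters and degree bounds over a local ring *)

Variable m : R -> Prop.
Hypothesis locR : local_with m.

Lemma prime_sub_max P : prime_ideal P -> subI P m.
Proof. by case=> iP [P1 _]; apply: (proper_sub_max noethR locR). Qed.

Lemma prime_over_primary Q P : m_primary m Q -> prime_ideal P -> subI Q P -> P = m.
Proof.
move=> [_ [_ [_ Qm]]] pP QP; have [iP [P1 Pab]] := pP.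
apply: subI_antisym; first exact: prime_sub_max.
move=> x /Qm[n /QP]; elim: n => [|n IH]; first by rewrite expr0.
by rewrite exprS => /Pab[|/IH].
Qed.

Lemma primary_of_primes Q : ideal Q -> ~ Q 1 ->
  (forall P, prime_ideal P -> subI Q P -> P = m) -> m_primary m Q.
Proof.
move=> iQ Q1 H; split=> //; split=> //; split.
  exact: (proper_sub_max noethR locR).
by move=> x mx; apply: radical_sub => // P pP /(H _ pP) ->.
Qed.

(** Noetherian induction: for [a b] in [K] with [a], [b] outside, [(K + (a)) / K] is a quotient of
    [R / (K : a)], and both [K : a] and [K + (a)] are strictly larger than [K]. *)
Lemma flen_primary Q : m_primary m Q -> flen Q (@fullI R).
Proof.
move=> mQ; have [iQ _] := mQ.
have := prime_over_primary mQ => {mQ}; move: Q iQ.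
apply: (noeth_ind noethR (P := fun Q =>
  (forall P, prime_ideal P -> subI Q P -> P = m) -> flen Q (@fullI R))).
move=> K iK IH prm.
case: (classic (K 1)) => K1.
  by rewrite (ideal1 iK K1); apply: flen_refl.
case: (classic (prime_ideal K)) => [pK|/(nonprime iK K1)[a [b [Kab nKa nKb]]]].
  by rewrite (prm _ pK (@subI_refl _ _)); case: (len_max locR).
have up L : ideal L -> ssubI K L -> flen L (@fullI R).
  move=> iL sL; apply: IH => // P pP LP; apply: prm => //.
  by case: sL => KL _; apply: subI_trans LP.
have iA := ideal_addx a iK (ideal_full R).
apply: (flen_trans (B := addx K a (@fullI R))); last by apply: up => //; apply: ssubI_addx.
have iT := ideal_pre a iK (ideal_full R).
have fT : flen (pre K a (@fullI R)) (@fullI R) by apply: up => //; apply: ssubI_pre Kab nKb.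
by have [|f _] := len_image (x := a) fT iK; first by move=> c [].
Qed.

Lemma flen_powI Q n : m_primary m Q -> flen (powI Q n) (@fullI R).
Proof.
move=> mQ; have fQ := flen_primary mQ; elim: n => [|n IH]; first exact: flen_refl.
have [f _] := len_prod_nu noethR fQ (ideal_powI Q n).
exact: flen_trans f IH.
Qed.

Variable d : nat.
Hypothesis dimR : krull_dim R d.

Lemma parameters_in J : m_primary m J ->
  exists xs : seq R, [/\ size xs = d, subI (span xs) J & m_primary m (span xs)].
Proof.
move=> mJ; have [iJ [J1 [Jm _]]] := mJ.
have [_ dim_le] := dimR.
(* The elements are chosen successively outside the listed primes that do not contain [J]. A prime
   over the first [i] of them is then [m] or the top of a prime chain of length [i]. *)
have step i : exists xs : seq R, [/\ size xs = i, forall x, x \in xs -> J x &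
    forall P, prime_ideal P -> subI (span xs) P ->
      P = m \/ exists f, prime_chain f i /\ f i = P].
  elim: i => [|i [xs [sz xsJ Hxs]]].
    exists [::]; split=> // P pP _; right; exists (fun=> P).
    by split=> //; split.
  have [Ps [Ps1 Ps2]] := primes_over (ideal_span xs).
  have [|x [Jx Hx]] := @prime_avoidance J Ps iJ; first by move=> P /Ps1[].
  exists (x :: xs); split=> [|y|P pP sP]; first by rewrite /= sz.
    by rewrite inE => /orP[/eqP ->|/xsJ].
  have mP : subI m P -> P = m.
    by move=> mP; apply: subI_antisym => //; apply: prime_sub_max.
  have sP' : subI (span xs) P.
    by apply: subI_trans sP; apply: span_subseq => y yxs; rewrite inE yxs orbT.
  have [P0 [inP0 P0P]] := Ps2 P pP sP'.
  have [pP0 sP0] := Ps1 _ inP0.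
  case: (Hx _ inP0) => [JP0|nP0x].
    by left; apply: mP; rewrite -(prime_over_primary mJ pP0 JP0).
  case: (Hxs _ pP0 sP0) => [E|[f [[pf sf] Ef]]]; first by left; apply: mP; rewrite -E.
  right; exists (fun j => if (j <= i)%N then f j else P); rewrite ltnn.
  split=> //; split=> [j _|j ji].
    by case: ifP => [/pf|].
  rewrite -ltnS ji; case: (ltnP j i) => lt; first exact: sf.
  have -> : j = i by lia.
  rewrite Ef; split=> // PP0; apply: nP0x; apply: PP0; apply: sP.
  by apply: span_mem; rewrite mem_head.
have [xs [sz xsJ Hxs]] := step d.
have sJ : subI (span xs) J by apply: span_min.
exists xs; split=> //; apply: primary_of_primes; [exact: ideal_span | by move/sJ |].
move=> P pP sP; case: (Hxs P pP sP) => // -[f [[pf sf] Ef]].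
case: (ssubI_or (prime_sub_max pP)) => // sPm.
(* A prime other than [m] over all [d] elements would extend to a chain of length [d + 1] ending in
   [m]. *)
have /dim_le : prime_chain (fun j => if (j <= d)%N then f j else m) d.+1.
  split=> [j _|j jd]; first by case: ifP => [/pf|_] //; apply: (prime_max noethR locR).
  rewrite -ltnS jd; case: (ltnP j d) => lt; first exact: sf.
  have -> : j = d by lia.
  by rewrite Ef; apply: sPm.
by rewrite ltnn.
Qed.

Lemma len_powS Q n : m_primary m Q ->
  [/\ flen (powI Q n.+1) (powI Q n), flen (powI Q n) (@fullI R) &
  len (powI Q n.+1) (@fullI R) =
    (len (powI Q n.+1) (powI Q n) + len (powI Q n) (@fullI R))%N].
Proof.
move=> mQ; have f2 := flen_powI n mQ.
have [f1 _] := len_prod_nu noethR (flen_primary mQ) (ideal_powI Q n).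
by split=> //; apply: len_add.
Qed.

Lemma stable_powI Q k : stable Q (fun n => powI Q (k + n)).
Proof.
split=> [n|n j a Qj Qa]; first exact: ideal_powI.
by rewrite addnS; apply: prodI_mem.
Qed.

Lemma evpoly_gens s : m_primary m (span s) ->
  evpoly (size s).+1 (fun n => (len (powI (span s) n.+1) (@fullI R))%:Z).
Proof.
move=> mQ; have [iQ _] := mQ.
apply: (@evpoly_sum _ _ (fun n => (len (powI (span s) n.+1) (powI (span s) n))%:Z) 0%N).
  by move=> n _; have [_ _ ->] := len_powS n.+1 mQ; rewrite PoszD addrK.
apply: (hilbert_serre noethR iQ (stable_powI _ 0) (stable_powI _ 1)).
- by move=> n; apply: subI_refl.
- by move=> n; have [] := len_powS n mQ.
- by move=> x; apply: span_mem.
move=> j Qj; exists j; split=> // n a _.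
by rewrite subrr mul0r; apply: (ideal0 (ideal_powI _ (1 + n.+1))).
Qed.

(** Arbitrary generators of [Q] give polynomiality with a poor degree bound; the degree is cut down
    by comparison with a parameter ideal inside [Q], whose powers have larger colength. *)
Lemma evpoly_hilbert Q : m_primary m Q ->
  evpoly d.+1 (fun n => (len (powI Q n.+1) (@fullI R))%:Z).
Proof.
move=> mQ; have [iQ _] := mQ.
have [xs [sz xsQ mxs]] := parameters_in mQ.
have [s Es] := noeth_span noethR iQ.
have eQ : evpoly (size s).+1 (fun n => (len (powI Q n.+1) (@fullI R))%:Z).
  by rewrite Es; apply: evpoly_gens; rewrite -Es.
have exs := evpoly_gens mxs; rewrite sz in exs.
apply: (evpoly_bound (N := 0) eQ exs) => n _.
have [_ le] := len_mono (flen_powI n.+1 mxs) (ideal_powI Q n.+1) (ideal_full R)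
  (powI_mono (n := n.+1) xsQ) (fun _ _ => I) (fun _ _ => I).
by rewrite le0z_nat lez_nat.
Qed.

(** As [Q] lies in [m], [nu (Q^n)] is at most the length of [Q^n / Q^(n+1)], a first difference of
    the Hilbert function. *)
Lemma evpoly_fiber Q : m_primary m Q ->
  evpoly d (fun n => (nu (powI Q n))%:Z).
Proof.
move=> mQ; have [iQ [_ [Qm _]]] := mQ.
have [s Es] := noeth_span noethR iQ.
have [fm _] := len_max locR.
have eD := evpoly_diff (evpoly_hilbert mQ).
have E n : nu (powI Q n) = len (prodI m (powI Q n)) (powI Q n).
  by apply: nu_len => //; apply: ideal_powI.
have fn n := len_prod_nu noethR fm (ideal_powI Q n).
have eF : evpoly (size s) (fun n => (nu (powI Q n))%:Z).
  suff [c [N H]] : evpoly (size s) (fun n => (len (prodI m (powI Q n)) (powI Q n))%:Z).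
    by exists c, N => n /H <-; rewrite E.
  apply: (hilbert_serre noethR iQ (stable_powI _ 0)).
  - split=> [n|n j a Qj]; first exact: ideal_prodI.
    move: a; rewrite /= prodIA (prodIC m Q) -prodIA.
    by move=> a; apply: (prodI_mem Qj).
  - by move=> n; apply: subI_refl.
  - by move=> n; case: (fn n).
  - by rewrite Es => x; apply: span_mem.
  move=> j Qj; exists j; rewrite -Es; split=> // n a _.
  by rewrite subrr mul0r; apply: (ideal0 (ideal_prodI _ _)).
apply: (evpoly_bound (N := 1) eF eD) => -[//|n] _.
have [f1 _ ->] := len_powS n.+1 mQ; rewrite PoszD addrK le0z_nat lez_nat E.
have iP := ideal_powI Q n.+1.
have [_ ->] := len_mono f1 (ideal_prodI m (powI Q n.+1)) iP
  (prodI_mono Qm (@subI_refl _ _)) (prodI_subr iP) (@subI_refl _ _).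
by [].
Qed.

End Primes.

(** * The length of I^n / J^n *)

Section Reduction.
Variable R : comNzRingType.
Variables (J : R -> Prop) (h : R).
Local Notation I := (adjoin J h).

Lemma ideal_adjoin : ideal I. Proof. exact: ideal_gen. Qed.

Lemma sub_adjoin : subI J I. Proof. by move=> x Jx; apply: gen_sub; left. Qed.

Lemma mem_adjoin : I h. Proof. by apply: gen_sub; right. Qed.

Hypothesis iJ : ideal J.

Lemma adjoinE : I = addx J h (@fullI R).
Proof.
have iA := ideal_addx h iJ (ideal_full R).
apply: subI_antisym.
  apply: gen_min => // x [|->]; first exact: addx_l.
  exact: addx_x.
apply: addx_min => [|x Jx|b _]; [exact: ideal_gen | by apply: gen_sub; left |].
by apply: (idealMr _ (ideal_gen _)); apply: gen_sub; right.
Qed.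

(** Expanding a product of [i + 1] factors [j + r h], every term with some [j] lies in [J I^i]; only
    a multiple of [h^(i+1)] remains. *)
Lemma powI_adjoin i :
  powI I i.+1 = addx (prodI J (powI I i)) (h ^+ i.+1) (@fullI R).
Proof.
apply: subI_antisym; last first.
  apply: addx_min => [||b _]; first exact: ideal_powI.
    exact: prodI_mono sub_adjoin (@subI_refl _ _).
  exact: (idealMr _ (ideal_powI I i.+1) (powI_exp i.+1 mem_adjoin)).
have iA k : ideal (addx (prodI J (powI I k)) (h ^+ k.+1) (@fullI R)).
  by apply: ideal_addx => //; apply: ideal_prodI.
elim: i => [|i IH]; apply: prodI_min => // a b.
  rewrite {1}adjoinE => -[j [r [Jj _ ->]]] _.
  rewrite mulrDl -mulrA; apply: (idealD (iA _)).
    by apply: addx_l => //; apply: prodI_mem.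
  by apply: addx_r => //; apply: ideal_prodI.
rewrite {1}adjoinE => -[j [r [Jj _ ->]]] Ib.
rewrite mulrDl; apply: (idealD (iA _)).
  by apply: addx_l => //; apply: prodI_mem.
have [u [t [Ju _ Eb]]] := IH _ Ib.
have -> : h * r * b = r * (h * u) + h ^+ i.+2 * (r * t).
  by rewrite Eb (exprS h i.+1); ring.
apply: (idealD (iA _)); last by apply: addx_r => //; apply: ideal_prodI.
apply: (idealMl _ (iA _)); apply: addx_l => //.
rewrite /= prodIA (prodIC J I) -prodIA.
exact: prodI_mem mem_adjoin Ju.
Qed.

(** An integral equation of degree [s + 1] writes [h^(s+1)] through terms in [J^i I^(s+1-i)] with
    [i >= 1], all inside [J I^s]. *)
Lemma integral_reduction : integral_over J h ->
  exists s, powI I s.+1 = prodI J (powI I s).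
Proof.
move=> [[|s] [a [k1 [Ja E]]]] //; exists s.
have iP := ideal_prodI J (powI I s).
apply: subI_antisym; last exact: prodI_mono sub_adjoin (@subI_refl _ _).
rewrite powI_adjoin; apply: addx_min => // b _; apply: (idealMr _ iP).
move/eqP: E; rewrite addr_eq0 => /eqP ->; apply: (idealN iP).
rewrite big_nat; apply: (ideal_sum _ iP) => -[//|i] lti.
have := prodI_mem (Ja _ lti) (powI_exp (s.+1 - i.+1) mem_adjoin).
rewrite /= -prodIA; apply: prodI_mono => //.
have -> : s = (i + (s.+1 - i.+1))%N by lia.
rewrite -powID.
have -> : ((i + (s.+1 - i.+1)).+1 - i.+1 = s.+1 - i.+1)%N by lia.
exact: prodI_mono (powI_mono sub_adjoin) (@subI_refl _ _).
Qed.

Lemma redP : integral_over J h ->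
  powI I (red J I).+1 = prodI J (powI I (red J I)).
Proof.
move=> /integral_reduction ex.
suff ex' : exists s, eqI (powI I s.+1) (prodI J (powI I s)) /\
    forall t, eqI (powI I t.+1) (prodI J (powI I t)) -> (s <= t)%N.
  by apply: eqI_eq; case: (epsilon_spec (inhabits 0%N) _ ex').
have [s Es] := ex; have [n] := ubnP s; elim: n s Es => // n IH s Es lt.
case: (classic (exists t, powI I t.+1 = prodI J (powI I t) /\ (t < s)%N)).
  by move=> [t [Et ts]]; apply: (IH t) => //; lia.
move=> N; exists s; rewrite Es; split=> // t /eqI_eq Et.
by rewrite leqNgt; apply/negP => ts; apply: N; exists t.
Qed.

Lemma powI_red s t : powI I s.+1 = prodI J (powI I s) ->
  powI I (s + t) = prodI (powI J t) (powI I s).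
Proof.
move=> Es; elim: t => [|t IH].
  by rewrite addn0 /= prodIC prodI_full //; apply: ideal_powI.
rewrite addnS /= IH prodIA (prodIC I) -prodIA -[prodI I _]/(powI I s.+1) Es.
by rewrite prodIA (prodIC _ J).
Qed.

Hypothesis noethR : noetherian R.
Hypothesis fJ : flen J (@fullI R).
Local Notation C := (colon J I).

Lemma flen_colon : flen C (@fullI R).
Proof.
have iC : ideal C.
  split; first by move=> x _; rewrite mul0r; apply: ideal0.
  split=> [x y Cx Cy z Iz|r x Cx z Iz].
    by rewrite mulrDl; apply: idealD => //; [apply: Cx | apply: Cy].
  by rewrite -mulrA; apply: idealMl => //; apply: Cx.
by apply: flen_r fJ iC _ _ => // x Jx y _; apply: idealMr.
Qed.

Lemma len_reduction_step k i :
  let D := prodI (powI J k.+1) (powI I i) in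
  let D' := prodI (powI J k) (powI I i.+1) in
  flen D D' /\ (len D D' <= nu (powI J k) * len C (@fullI R))%N.
Proof.
move=> D D'; have iD : ideal D by apply: ideal_prodI.
have iD' : ideal D' by apply: ideal_prodI.
have iJk := ideal_powI J k.
have DE : D = prodI (powI J k) (prodI J (powI I i)).
  by rewrite prodIA (prodIC _ J).
have -> : D' = addx D (h ^+ i.+1) (powI J k).
  apply: subI_antisym.
    apply: prodI_min => [|a b Ja]; first exact: ideal_addx.
    rewrite powI_adjoin => -[u [t [Ju _ ->]]].
    have -> : a * (u + h ^+ i.+1 * t) = a * u + h ^+ i.+1 * (a * t) by ring.
    exists (a * u), (a * t); split=> //; last exact: idealMr.
    by rewrite DE; apply: prodI_mem.
  apply: addx_min => // [|b Jb].
    by rewrite DE; apply: prodI_mono (prodI_mono sub_adjoin _).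
  by rewrite mulrC; apply: prodI_mem Jb (powI_exp i.+1 mem_adjoin).
have [f le] := len_prod_nu noethR flen_colon iJk.
have [|f' le'] := len_image (x := h ^+ i.+1) f iD.
  (* For [c] in [J : I] the product [c h] lies in [J]; one factor [h] is spent on this and [h^i]
     remains in [I^i]. *)
  suff sub : subI (prodI C (powI J k)) (pre D (h ^+ i.+1) (@fullI R)) by move=> b /sub[].
  apply: prodI_min => [|c b Cc Jb]; first exact: ideal_pre.
  split=> //; have -> : h ^+ i.+1 * (c * b) = (c * h * b) * h ^+ i by rewrite exprS; ring.
  apply: prodI_mem; last exact: powI_exp mem_adjoin.
  by apply: prodI_mem => //; apply: Cc mem_adjoin.
by split=> //; apply: leq_trans le' le.
Qed.

Lemma len_reduction s n : powI I s.+1 = prodI J (powI I s) -> (s <= n)%N ->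
  flen (powI J n.+1) (powI I n.+1) /\
  (len (powI J n.+1) (powI I n.+1) <=
     (\sum_(i < s) nu (powI J (n - i))) * len C (@fullI R))%N.
Proof.
move=> Es sn; pose D i := prodI (powI J (n.+1 - i)) (powI I i).
have iD i : ideal (D i) by apply: ideal_prodI.
have ED0 : D 0%N = powI J n.+1.
  by rewrite /D subn0 prodI_full //; apply: ideal_powI.
have EDs : D s = powI I n.+1.
  by rewrite /D -powI_red // subnKC // leqW.
rewrite -ED0 -EDs; elim: {-2}s (leqnn s) => [|i IH] lt.
  by rewrite big_ord0 len_refl //; split=> //; apply: flen_refl.
have [|f le] := IH; first exact: ltnW.
have [f' le'] := len_reduction_step (n - i) i.
have E : (n - i).+1 = (n.+1 - i)%N by lia.
have E' : (n - i)%N = (n.+1 - i.+1)%N by lia.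
have [{}f' {}le'] : flen (D i) (D i.+1) /\
    (len (D i) (D i.+1) <= nu (powI J (n - i)) * len C (@fullI R))%N.
  by rewrite /D -E -E'.
split; first exact: flen_trans f f'.
by rewrite (len_add f f') big_ord_recr /= mulnDl leq_add.
Qed.

End Reduction.

(** * Comparison of coefficients *)

Section Coefficients.
Variable R : comNzRingType.
Variables (m : R -> Prop) (d : nat).
Hypotheses (noethR : noetherian R) (locR : local_with m).
Hypothesis dimR : krull_dim R d.

Lemma hilb_binpoly (e : nat -> int) n :
  \sum_(i < d.+1) (-1) ^+ i * e i * ('C(n + d - i, d - i))%:Z =
  binpoly d.+1 (fun j => (-1) ^+ (d - j)%N * e (d - j)%N) n.
Proof.
rewrite /binpoly (reindex_inj rev_ord_inj) /=; apply: eq_bigr => i _.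
rewrite !subSS; have id := ltn_ord i.
have -> : (d - (d - i) = i)%N by lia.
by have -> : (n + d - (d - i) = n + i)%N by lia.
Qed.

(** Polynomiality provides a witness, so the [epsilon] in [hilb_coeff] really returns coefficients;
    the sum is reversed since [e_i] belongs to index [d - i]. *)
Lemma hilb_coeffP Q : m_primary m Q -> exists N, forall n, (N <= n)%N ->
  (len (powI Q n.+1) (@fullI R))%:Z =
  binpoly d.+1 (fun j => (-1) ^+ (d - j)%N * hilb_coeff Q d (d - j)%N) n.
Proof.
move=> mQ; have [c [N Hc]] := evpoly_hilbert noethR locR dimR mQ.
have lE n := lengthR_len (flen_powI noethR locR n.+1 mQ).
have ex : exists e : nat -> int, exists N, forall n, (N <= n)%N ->
    (lengthR (powI Q n.+1))%:Z =
    \sum_(i < d.+1) (-1) ^+ i * e i * ('C(n + d - i, d - i))%:Z.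
  exists (fun i => (-1) ^+ i * c (d - i)%N), N => n /Hc.
  rewrite lE (hilb_binpoly (fun i => (-1) ^+ i * c (d - i)%N)) => ->; apply: eq_binpoly => j jd.
  have -> : (d - (d - j) = j)%N by lia.
  by rewrite mulrA -exprD addnn -mul2n exprM sqrrN !expr1n mul1r.
have [M HM] := epsilon_spec (inhabits (fun=> 0)) _ ex.
by exists M => n /HM; rewrite lE hilb_binpoly.
Qed.

Lemma f0P Q : (1 <= d)%N -> m_primary m Q ->
  exists c N, c d.-1 = f0 Q d /\ forall n, (N <= n)%N ->
  (nu (powI Q n))%:Z = binpoly d c n.
Proof.
move=> d1 mQ; have [c [N Hc]] := evpoly_fiber noethR locR dimR mQ.
have shape (e : nat -> int) a n : binpoly d (fun j => if (j < d.-1)%N then e j else a) n =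
    a * ('C(n + d - 1, d - 1))%:Z + \sum_(j < d.-1) e j * ('C(n + j, j))%:Z.
  have -> : (n + d - 1 = n + d.-1)%N by lia.
  rewrite subn1 -{1}(prednK d1) binpolyS ltnn addrC; congr (_ + _).
  by apply: eq_bigr => j _; rewrite ltn_ord.
have ex : exists a : int, exists (e : nat -> int) N, forall n, (N <= n)%N ->
    (nu (powI Q n))%:Z =
    a * ('C(n + d - 1, d - 1))%:Z + \sum_(j < d.-1) e j * ('C(n + j, j))%:Z.
  exists (c d.-1), c, N => n /Hc ->; rewrite -shape; apply: eq_binpoly => j jd.
  by case: ltnP => // dj; congr c; lia.
have [e [M HM]] := epsilon_spec (inhabits 0) _ ex.
exists (fun j => if (j < d.-1)%N then e j else f0 Q d), M; split=> [|n /HM ->].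
  by rewrite ltnn.
by rewrite shape.
Qed.

End Coefficients.

(** * Comparison of leading coefficients *)

Section TopCoefficient.
Implicit Types (u v : nat -> int) (a b : int).

(** Here [a] is [k!] times the coefficient of [n^k], and may be 0; it is unchanged by translating
    [n]. *)
Definition evtop k a u := exists (c : nat -> int) N,
  c k = a /\ forall n, (N <= n)%N -> u n = binpoly k.+1 c n.

Lemma evtopD k a b u v : evtop k a u -> evtop k b v ->
  evtop k (a + b) (fun n => u n + v n).
Proof.
move=> [c [N [<- Hc]]] [e [M [<- He]]]; exists (fun j => c j + e j), (maxn N M).
by split=> // n; rewrite geq_max => /andP[/Hc -> /He ->]; rewrite binpolyD.
Qed.

Lemma evtopZ k a b u : evtop k a u -> evtop k (b * a) (fun n => b * u n).
Proof.
move=> [c [N [<- Hc]]]; exists (fun j => b * c j), N.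
by split=> // n /Hc ->; rewrite binpolyZ.
Qed.

Lemma evtop_pred k a u : evtop k a u -> evtop k a (fun n => u n.-1).
Proof.
move=> [c [N [<- Hc]]].
exists (fun j => c j - (if (j < k)%N then c j.+1 else 0)), N.+1.
by split=> [|[//|n] Nn]; rewrite ?ltnn ?subr0 // -binpoly_shift Hc.
Qed.

Lemma evtop_ext k a u v : u =1 v -> evtop k a u -> evtop k a v.
Proof. by move=> uv [c [N [Ec Hc]]]; exists c, N; split=> // n /Hc <-. Qed.

Lemma evtop_sub k a u i : evtop k a u -> evtop k a (fun n => u (n - i)%N).
Proof.
move=> eu; elim: i => [|i /evtop_pred]; first by apply: evtop_ext eu => n; rewrite subn0.
by apply: evtop_ext => n; congr u; lia.
Qed.

Lemma evtop_sum k a u s : evtop k a u ->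
  evtop k (s%:Z * a) (fun n => \sum_(i < s) u (n - i)%N).
Proof.
move=> eu; elim: s => [|s IH].
  exists (fun=> 0), 0%N; split=> [|n _]; first by rewrite mul0r.
  by rewrite big_ord0 /binpoly big1 // => j _; rewrite mul0r.
have -> : s.+1%:Z * a = s%:Z * a + a by rewrite -addn1 PoszD mulrDl mul1r.
by apply: evtop_ext (evtopD IH (evtop_sub s eu)) => n; rewrite big_ord_recr.
Qed.

(* A polynomial of formal degree [k+1] squeezed between [0] and one of degree
   [k] has no term of degree [k+1]. *)
Lemma evtop_squeeze k c a u v N : (forall n, (N <= n)%N -> u n = binpoly k.+2 c n) ->
  evtop k a v -> (forall n, (N <= n)%N -> 0 <= u n <= v n) -> c k <= a.
Proof.
move=> Hu [e [M [<- He]]] uv; pose L := maxn N M.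
have ck1 : c k.+1 <= 0.
  have := @binpoly_le0 k.+1 (fun j => c j - if (j < k.+1)%N then e j else 0) L.
  rewrite ltnn subr0; apply => n; rewrite geq_max => /andP[Nn Mn].
  rewrite binpolyB binpoly_pad // -Hu // -He //; have := uv n Nn; lia.
have ck2 : - c k.+1 <= 0.
  apply: (@binpoly_le0 k.+1 (fun j => - c j) N) => n Nn; rewrite binpolyN -Hu //.
  by have := uv n Nn; lia.
have c0 : c k.+1 = 0 by lia.
rewrite -subr_le0; apply: (@binpoly_le0 k (fun j => c j - e j) L) => n.
rewrite geq_max => /andP[Nn Mn]; have := uv n Nn.
by rewrite Hu // He // binpolyS c0 mul0r addr0 binpolyB; lia.
Qed.

End TopCoefficient.

Theorem theorem2p3 (R : comNzRingType) (m : R -> Prop) (d : nat)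
    (J : R -> Prop) (h : R) :
  noetherian R -> local_with m -> krull_dim R d -> (1 <= d)%N ->
  m_primary m J -> integral_over J h ->
  hilb_coeff (adjoin J h) d 1 - hilb_coeff J d 1 <=
    ((red J (adjoin J h) * lengthR (colon J (adjoin J h)))%N)%:Z * f0 J d.
Proof.
move=> noethR locR dimR d1 mJ int_h; set I := adjoin J h.
have [iJ [J1 [Jm Jpow]]] := mJ.
have Es := redP iJ int_h; rewrite -/I in Es; set s := red J I in Es *.
have pm := prime_max noethR locR.
have mh : m h.
  (* The power [h^(s+1)] lies in [I^(s+1) = J I^s], hence in [J] and in the prime [m]. *)
  have [k hk] : exists k, m (h ^+ k.+1).
    exists s; apply: Jm; apply: (prodI_subl (B := powI I s) iJ).
    by rewrite -Es; apply: powI_exp; apply: mem_adjoin.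
  have [_ [m1 mab]] := pm; elim: k hk => [|k IH]; first by rewrite expr1.
  by rewrite exprS => /mab[|/IH].
have Im : subI I m.
  by apply: gen_min => [|x [/Jm|->]] //; apply: (ideal_max locR).
have mI : m_primary m I.
  split; first exact: ideal_adjoin.
  split; first by move/Im; apply: (max_proper locR).
  split=> // x /Jpow[n Jn]; exists n; exact: sub_adjoin.
have fJ := flen_primary noethR locR mJ.
rewrite (lengthR_len (flen_colon h iJ fJ)); set L := len _ _.
have [N1 HJ] := hilb_coeffP noethR locR dimR mJ.
have [N2 HI] := hilb_coeffP noethR locR dimR mI.
have [c [N3 [Ec Hc]]] := f0P noethR locR dimR d1 mJ.
case: d d1 dimR HJ HI c Ec Hc => // d _ _ HJ HI c /= Ec Hc.
have eF : evtop d (f0 J d.+1) (fun n => (nu (powI J n))%:Z) by exists c, N3.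
have := evtop_squeeze (N := maxn s (maxn N1 N2))
  (u := fun n => (len (powI J n.+1) (@fullI R))%:Z - (len (powI I n.+1) (@fullI R))%:Z)
  (c := fun j => (-1) ^+ (d.+1 - j)%N * hilb_coeff J d.+1 (d.+1 - j)%N
              - (-1) ^+ (d.+1 - j)%N * hilb_coeff I d.+1 (d.+1 - j)%N)
  _ (evtopZ L%:Z (evtop_sum s eF)).
(* The dimension is now [d.+1], so index [d] carries [-e_1(J)] and [-e_1(I)]; the difference has
   coefficient [e_1(I) - e_1(J)] there. *)
have -> : (d.+1 - d = 1)%N by lia.
rewrite expr1 !mulN1r opprK addrC mulrA -PoszM mulnC; apply.
  by move=> n; rewrite !geq_max => /and3P[_ /HJ -> /HI ->]; rewrite binpolyB.
move=> n; rewrite geq_max => /andP[sn _].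
have [f le] := len_reduction iJ noethR fJ Es sn.
rewrite (len_add f (flen_powI noethR locR n.+1 mI)) PoszD addrK le0z_nat /=.
have -> : \sum_(i < s) (nu (powI J (n - i)))%:Z = (\sum_(i < s) nu (powI J (n - i)))%N%:Z.
  by rewrite (big_morph Posz PoszD (erefl 0%:Z)).
by rewrite -PoszM lez_nat mulnC.
Qed.
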